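(* Let $F(n)$ denote the number of unordered factorizations of a positive integer $n$ into pairwise coprime integers larger than one. For every fixed $\beta \in (0,1)$, as $x\to\infty$, \[\sum_{n \leq x} F(n)^\beta = x\exp\left((1 + o(1)) \left(\frac{(1 - \beta) \log_2 x}{(\log_3 x)^\beta}\right)^{1/(1 - \beta)}\right).\]
   Context: $\log_k$ denotes the $k$-th iterate of the natural logarithm. *)

(* Defs.v *)
From HB Require Import structures.
From mathcomp Require Import all_boot all_order all_algebra.
From mathcomp Require Import all_classical all_reals all_analysis.

Set Implicit Arguments.
Unset Strict Implicit.
Unset Printing Implicit Defensive.

Import Order.TTheory GRing.Theory Num.Theory.
Import numFieldNormedType.Exports.

Local Open Scope ring_scope.

(* An unordered factorization is a multiset of factors; factors that are > 1
   and pairwise coprime cannot repeat, so it is a finite set A, and for n > 0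
   its elements divide n, hence lie in {0, ..., n}.  The empty set is the
   (only) factorization of 1. *)
Definition coprime_factorization (n : nat) (A : {set 'I_n.+1}) : bool :=
  [&& [forall d in A, (1 < d)%N],
      [forall d in A, forall e in A, (d != e) ==> coprime d e]
    & (\prod_(d in A) (d : nat))%N == n].

Definition num_coprime_factorizations (n : nat) : nat :=
  #|[set A : {set 'I_n.+1} | coprime_factorization A]|.

Definition iter_ln (R : realType) (k : nat) (x : R) : R := iter k (@ln R) x.

(* Main.v *)
Require Import Defs.
From mathcomp Require Import all_boot all_order all_algebra.
From mathcomp Require Import all_classical all_reals all_analysis.
From mathcomp Require Import zify ring lra.

Import Order.TTheory GRing.Theory Num.Theory.
Import numFieldNormedType.Exports.

(* Idea.  Colour the primes of n with m colours.  The colour classes cut n into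
   m pairwise coprime parts, which compares F(n), and the number F_m(n) of
   factorizations into exactly m factors, with the moment m^omega(n):
     m! F_m(n) <= m^omega(n) <= (m+1)^m F(n).
   So the sum of F^beta is governed by sum_(n <= x) v^omega(n) / m^(beta m) with
   v = m^beta, and with t = ln (ln x) this moment is x exp((1 + o(1)) v t) up to
   errors that are negligible here.
   Upper bound: k^omega(n) is at most the number of k-tuples with product n, so
   the moment is at most x (1 + ln x)^k for k >= v; Young's inequality bounds all
   m at once.
   Lower bound: v^omega(n) >= (v-1)^j C(omega(n), j), and summing over n brings
   in the j-th elementary symmetric function of the 1/p, j < p <= x^(1/j), which
   is about t^j/j! by the divergence of the sum of 1/p; take j near v t.
   The maximum of m^beta t - beta m ln m is reached near
     m = ((1-beta) t / ln t)^(1/(1-beta)),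
   and the main exponent equals m ln t = (1-beta) t m^beta. *)

(** * Colourings of the primes of n *)

(* The primes of [n] coloured [i] by [g]; numbers outside [primes n] have no
   colour. *)
Definition colour_class {n m : nat} (g : {ffun seq_sub (primes n) -> 'I_m})
    (i : 'I_m) : nat_pred :=
  [pred p | if insub p is Some q then g q == i else false].

Definition colour_part {n m : nat} (g : {ffun seq_sub (primes n) -> 'I_m})
    (i : 'I_m) : nat := n`_(colour_class g i).

Lemma val_colour_class {n m : nat} (g : {ffun seq_sub (primes n) -> 'I_m})
    (q : seq_sub (primes n)) (i : 'I_m) :
  (val q \in colour_class g i) = (g q == i).
Proof. by rewrite inE /= valK. Qed.

Lemma colour_class_inj {n m : nat} (g : {ffun seq_sub (primes n) -> 'I_m})
    (i j : 'I_m) (p : nat) :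
  p \in colour_class g i -> p \in colour_class g j -> i = j.
Proof. by rewrite !inE; case: insub => //= q /eqP <- /eqP. Qed.

Lemma colour_part_gt0 {n m : nat} (g : {ffun seq_sub (primes n) -> 'I_m}) i :
  0 < colour_part g i.
Proof. exact: part_gt0. Qed.

Lemma colour_part_le {n m : nat} (g : {ffun seq_sub (primes n) -> 'I_m}) i :
  0 < n -> colour_part g i < n.+1.
Proof. by move=> n_gt0; rewrite ltnS dvdn_leq// dvdn_part. Qed.

Lemma prod_colour_part {n m : nat} (g : {ffun seq_sub (primes n) -> 'I_m}) :
  0 < n -> \prod_i colour_part g i = n.
Proof.
move=> n_gt0; rewrite -[RHS](partnT n_gt0) /colour_part /partn.
rewrite (exchange_big_dep predT)//=; apply: eq_bigr => p _.
have [pn|pn] := boolP (p \in primes n).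
  rewrite -(SubK (seq_sub (primes n)) pn).
  under eq_bigl do rewrite val_colour_class.
  by rewrite (big_pred1 (g (Sub p pn))).
rewrite [logn p n](_ : _ = 0) ?expn0 ?big1//.
by apply/eqP; rewrite -leqn0 leqNgt logn_gt0.
Qed.

Lemma coprime_colour_part {n m : nat} (g : {ffun seq_sub (primes n) -> 'I_m})
    (i j : 'I_m) : i != j -> coprime (colour_part g i) (colour_part g j).
Proof.
move=> ij; apply: (@pnat_coprime (colour_class g i)); first exact: part_pnat.
apply: sub_in_pnat (part_pnat (colour_class g j) n) => p _ pj.
by apply/negP => /colour_class_inj/(_ pj)/eqP; rewrite (negPf ij).
Qed.

(** A prime q of n divides only the part of its own colour, so the parts determine the colouring. *)
Lemma colour_part_inj {n m : nat} (g h : {ffun seq_sub (primes n) -> 'I_m}) :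
  colour_part g =1 colour_part h -> g = h.
Proof.
move=> gh; apply/ffunP => q; apply/esym/eqP; rewrite -val_colour_class.
have : val q \in primes (colour_part g (g q)).
  by rewrite primes_part mem_filter val_colour_class eqxx; exact: ssvalP.
by rewrite gh primes_part mem_filter => /andP[].
Qed.

(** The order of the entries matters, and entries equal to 1 are allowed and may repeat; these are
    the families of parts that colourings produce. *)
Definition coprime_tuple (n : nat) {m : nat} (t : 'I_m -> nat) : bool :=
  [forall i, forall j, (i != j) ==> coprime (t i) (t j)] &&
  (\prod_i t i == n).

(** Each prime of n divides some entry, and only one by coprimality; the index of that entry is its
    colour. *)
Lemma coprime_tuple_colour {n m : nat} (t : 'I_m -> nat) :
  0 < n -> coprime_tuple n t ->
  exists g : {ffun seq_sub (primes n) -> 'I_m}, colour_part g =1 t.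
Proof.
move=> n_gt0 /andP[/'forall_'forall_implyP cop /eqP prodt].
have t_gt0 i : 0 < t i.
  by have := n_gt0; rewrite -prodt (bigD1 i)//= muln_gt0 => /andP[].
have /fin_all_exists[f fP] : forall q : seq_sub (primes n), exists i, val q %| t i.
  move=> q; have := ssvalP q; rewrite mem_primes => /and3P[pq _ qn].
  have : val q %| \prod_i t i by rewrite prodt.
  by rewrite Euclid_dvd_prod// big_orE => /existsP[i qi]; exists i.
exists [ffun q => f q] => i; set g := [ffun q => _].
have gP p : prime p -> p %| n -> forall j, (p \in colour_class g j) = (p %| t j).
  move=> pp pn j; have pn' : p \in primes n by rewrite mem_primes pp n_gt0.
  rewrite -(SubK (seq_sub (primes n)) pn') val_colour_class ffunE.
  apply/eqP/idP => [<-//|pj]; apply/eqP/negP => /negP/cop cop_f.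
  have : p %| gcdn (t (f (Sub p pn'))) (t j).
    by rewrite dvdn_gcd pj andbT; have := fP (Sub p pn'); rewrite SubK.
  by rewrite (eqP cop_f) dvdn1 => /eqP p1; rewrite p1 in pp.
(* Writing n as the product of the entries, [t i] is its own part for the class of i, and the other
   entries have no prime in that class. *)
have -> : colour_part g i = (\prod_i t i)`_(colour_class g i) by rewrite prodt.
rewrite (bigD1 i)//= partnM//; last first.
  by rewrite prodn_gt0.
rewrite part_pnat_id ?part_p'nat ?muln1//.
  apply/pnatP; first by rewrite prodn_gt0.
  move=> p pp pr; rewrite inE/= gP//; last first.
    by rewrite -prodt (bigD1 i)//= dvdn_mull.
  apply/negP => pi; move: pr; rewrite Euclid_dvd_prod// big_orE.
  case/existsP => j /andP[ji pj]; have : p %| gcdn (t i) (t j) by rewrite dvdn_gcd pi.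
  by rewrite (eqP (cop i j _)) 1?eq_sym// dvdn1 => /eqP p1; rewrite p1 in pp.
apply/pnatP => // p pp pi; rewrite gP//.
by rewrite -prodt (bigD1 i)//= dvdn_mulr.
Qed.

Lemma card_colouring (n m : nat) :
  #|{ffun seq_sub (primes n) -> 'I_m}| = m ^ size (primes n).
Proof. by rewrite card_ffun card_ord card_seq_sub// primes_uniq. Qed.

Lemma card_coprime_tuple (n m : nat) :
  0 < n -> #|[set t : {ffun 'I_m -> 'I_n.+1} | coprime_tuple n (fun i => t i)]| <= m ^ size (primes n).
Proof.
move=> n_gt0; rewrite -card_colouring.
pose h (g : {ffun seq_sub (primes n) -> 'I_m}) : {ffun 'I_m -> 'I_n.+1} :=
  [ffun i => inord (colour_part g i)].
apply: leq_trans (leq_imset_card h predT); apply: subset_leq_card.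
apply/fintype.subsetP => t; rewrite inE => /(coprime_tuple_colour _ n_gt0)[g gE].
apply/imsetP; exists g => //; apply/ffunP => i; apply/val_inj.
by rewrite ffunE /= inordK ?gE// -gE colour_part_le.
Qed.

(** A set of m factors has m! enumerations, each of them a coprime m-tuple with product n, and there
    are at most m^omega(n) such tuples. *)
Lemma card_coprime_factorizations_size_le (n m : nat) : 0 < n ->
  m`! * #|[set A : {set 'I_n.+1} | coprime_factorization A & #|A| == m]|%SET
    <= m ^ size (primes n).
Proof.
move=> n_gt0; set S := [set A | _ & _]%SET.
apply: leq_trans (card_coprime_tuple _ m n_gt0).
pose enumeration (A : {set 'I_n.+1}) (t : {ffun 'I_m -> 'I_n.+1}) :=
  (t \in ffun_on (mem A)) && injectiveb t.
pose Q := [set u : {set 'I_n.+1} * {ffun 'I_m -> 'I_n.+1} |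
  (u.1 \in S) && enumeration u.1 u.2]%SET.
have -> : m`! * #|S| = #|Q|.
  rewrite -[RHS]sum1_card (eq_bigl _ _ (fun u => finset.in_set _ u)).
  rewrite -(pair_big_dep (mem S) enumeration (fun _ _ => 1))/= mulnC -sum_nat_const.
  apply: eq_bigr => A; rewrite inE => /andP[_ /eqP cA].
  have := card_inj_ffuns_on 'I_m (mem A).
  rewrite card_ord cA ffactnn sum1dep_card => <-.
  by apply: eq_card => t; rewrite !inE.
(* An injective enumeration by m indices of a set with m elements is onto. The set is thus recovered
   from the enumeration, and [snd] is injective on [Q]. *)
have imQ u : u \in Q -> u.1 = [set u.2 i | i : 'I_m]%SET.
  rewrite !inE => /andP[/andP[_ /eqP cA] /andP[/ffun_onP uA /injectiveP u_inj]].
  apply/esym/eqP; rewrite eqEcard card_imset// card_ord cA leqnn andbT.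
  by apply/fintype.subsetP => _ /imsetP[i _ ->]; exact: uA.
rewrite -(card_in_imset (f := snd) (D := Q)); last first.
  move=> [A t] [B s] /imQ/= -> /imQ/= -> /= -> //.
apply: subset_leq_card; apply/fintype.subsetP => _ /imsetP[u uQ ->].
have := uQ; rewrite !inE => /andP[/andP[/and3P[_ copA prodA] _]].
move=> /andP[/ffun_onP uA /injectiveP u_inj]; apply/andP; split.
  apply/'forall_'forall_implyP => i j ij.
  move/'forall_implyP: copA => /(_ _ (uA i)) /'forall_implyP/(_ _ (uA j)) /implyP.
  by apply; apply: contra ij => /eqP/u_inj ->.
move: prodA; rewrite (imQ _ uQ) big_imset//=.
by move=> i j _ _; exact: u_inj.
Qed.

(** Send a colouring to the set A of its parts larger than 1. In the fibre over A every part lies in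
    A or equals 1, which leaves at most m + 1 values for each of the m parts. *)
Lemma expn_primes_le_factorizations (n m : nat) : 0 < n ->
  m ^ size (primes n) <= m.+1 ^ m * num_coprime_factorizations n.
Proof.
move=> n_gt0; rewrite -card_colouring -sum1_card.
pose part g (i : 'I_m) : 'I_n.+1 := inord (@colour_part n m g i).
have partE g i : part g i = colour_part g i :> nat by rewrite inordK ?colour_part_le.
pose fact_of g := [set part g i | i in [pred i | 1 < part g i]]%SET.
have inj_part g : {in [pred i | 1 < part g i] &, injective (part g)}.
  move=> i j; rewrite !inE => gi gj /(congr1 val)/= ij; apply/eqP/negP => /negP/(coprime_colour_part g).
  by rewrite -!partE -ij /coprime gcdnn => /eqP g1; rewrite g1 in gi.
have factP g : fact_of g \in [set A : {set 'I_n.+1} | coprime_factorization A]%SET.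
  rewrite inE; apply/and3P; split.
  - by apply/'forall_implyP => _ /imsetP[i i1 ->].
  - apply/'forall_implyP => _ /imsetP[i i1 ->].
    apply/'forall_implyP => _ /imsetP[j j1 ->]; apply/implyP => ij.
    rewrite !partE coprime_colour_part//.
    by apply: contra ij => /eqP ->.
  - rewrite big_imset/=; last exact: inj_part.
    rewrite -[X in _ == X](prod_colour_part g n_gt0) big_mkcond/=.
    apply/eqP; apply: eq_bigr => i _; rewrite inE partE.
    by have := colour_part_gt0 g i; case: (colour_part g i) => [|[|]].
rewrite (partition_big fact_of [in [set A : {set 'I_n.+1} | coprime_factorization A]%SET])//=.
rewrite /num_coprime_factorizations mulnC -sum_nat_const; apply: leq_sum => A _.
rewrite sum1dep_card.
pose h g := [ffun i => part g i].
have h_inj : injective h.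
  move=> g g' /ffunP gg'; apply: colour_part_inj => i.
  by rewrite -!partE; have := gg' i; rewrite !ffunE => ->.
(* An empty fibre is trivial. Otherwise a colouring [g0] in the fibre shows that A has at most m
   elements. *)
have [->//|/card_gt0P[g0]] := posnP #|[set g | fact_of g == A]%SET|.
rewrite inE => /eqP g0A.
rewrite -(card_imset _ h_inj).
apply: (@leq_trans #|ffun_on (mem (inord 1 |: A)%SET) : pred {ffun 'I_m -> 'I_n.+1}|).
  apply: subset_leq_card; apply/fintype.subsetP => _ /imsetP[g + ->].
  rewrite inE => /eqP <-; apply/ffun_onP => i; rewrite ffunE in_setU1.
  have [gi|] := ltnP 1 (part g i); first by rewrite imset_f ?orbT.
  rewrite leq_eqVlt ltnS leqn0 orbC partE eqn0Ngt colour_part_gt0/= => /eqP g1.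
  by apply/orP; left; apply/eqP; rewrite /part g1.
have leq_expn a b e : a <= b -> a ^ e <= b ^ e.
  by case: e => // e ab; rewrite leq_exp2r.
rewrite card_ffun_on card_ord; apply: leq_expn.
rewrite cardsU1; apply: (@leq_add _ _ 1 m); rewrite ?leq_b1// -g0A.
by rewrite (leq_trans (leq_imset_card _ _))// (leq_trans (max_card _))// card_ord.
Qed.

(** The bound N gives all n <= N the same finite type of tuples, so that the sum over n can later be
    exchanged with the sum over tuples. *)
Lemma expn_primes_le_tuples (n N k : nat) : 0 < n <= N ->
  k ^ size (primes n) <= #|[set t : {ffun 'I_k -> 'I_N.+1} | \prod_i t i == n]|%SET.
Proof.
move=> /andP[n_gt0 nN]; rewrite -card_colouring.
pose h (g : {ffun seq_sub (primes n) -> 'I_k}) : {ffun 'I_k -> 'I_N.+1} :=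
  [ffun i => inord (colour_part g i)].
have hE g i : h g i = colour_part g i :> nat.
  by rewrite ffunE inordK// (leq_trans (colour_part_le g i n_gt0)).
have h_inj : injective h.
  by move=> g g' gg'; apply: colour_part_inj => i; rewrite -!hE gg'.
rewrite -(card_imset _ h_inj); apply: subset_leq_card.
apply/fintype.subsetP => _ /imsetP[g _ ->]; rewrite inE.
by under eq_bigr do rewrite hE; rewrite prod_colour_part.
Qed.

Local Open Scope classical_set_scope.
Local Open Scope ring_scope.

(** * The upper bound *)

Lemma coprime_factorization_size (n : nat) (A : {set 'I_n.+1}) :
  coprime_factorization A -> (2 ^ #|A| <= n)%N.
Proof.
move=> /and3P[/'forall_implyP A1 _ /eqP prodA].
apply: (@leq_trans (\prod_(d in A) d)); last by rewrite prodA.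
by rewrite -prod_nat_const; apply: leq_prod => d /A1.
Qed.

(** Subadditivity of z^b for b <= 1: a ratio u in [0, 1] satisfies u <= u^b; apply this to x / (x +
    y) and y / (x + y), and add. *)
Lemma ge0_sum_powR_le (R : realType) (b : R) (I : Type) (s : seq I) (P : pred I)
    (a : I -> R) : 0 < b <= 1 -> (forall i, 0 <= a i) ->
  (\sum_(i <- s | P i) a i) `^ b <= \sum_(i <- s | P i) a i `^ b.
Proof.
move=> /andP[b0 b1] a0.
have subadd (x y : R) : 0 <= x -> 0 <= y -> (x + y) `^ b <= x `^ b + y `^ b.
  move=> x0 y0; have [xy|xy] := eqVneq (x + y) 0.
    by rewrite xy powR0 ?gt_eqF// addr_ge0 ?powR_ge0.
  have xy0 : 0 < x + y by rewrite lt0r xy addr_ge0.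
  have part z : 0 <= z <= x + y -> z / (x + y) * (x + y) `^ b <= z `^ b.
    move=> /andP[]; rewrite le_eqVlt => /predU1P[<- _|z0 zxy].
      by rewrite mul0r mul0r powR_ge0.
    have -> : z `^ b = (z / (x + y)) `^ b * (x + y) `^ b.
      by rewrite -powRM ?divr_ge0 ?ltW// divfK// gt_eqF.
    apply: ler_wpM2r; first exact: powR_ge0.
    by apply: ger1_powR => //; rewrite divr_gt0//= ler_pdivrMr// mul1r.
  have := lerD (part x _) (part y _).
  by rewrite -mulrDl -mulrDl divff// mul1r; apply; apply/andP; split => //; lra.
have s0 (t : seq I) : 0 <= \sum_(i <- t | P i) a i by exact: sumr_ge0.
elim: s => [|i s ih]; first by rewrite !big_nil powR0 ?gt_eqF.
rewrite !big_cons; case: (P i) => //.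
by apply: (le_trans (subadd _ _ _ _)) => //; rewrite lerD2l.
Qed.

Lemma powR_expn (R : realType) (x b : R) (n : nat) :
  0 <= x -> (x ^+ n) `^ b = (x `^ b) ^+ n.
Proof.
by move=> x0; rewrite -(powR_mulrn n x0) -(powR_mulrn n (powR_ge0 x b)) powRAC.
Qed.

Lemma ln2_ge_half (R : realType) : 2^-1 <= ln (2 : R).
Proof.
have := @le_ln1Dx R (- 2^-1); rewrite (_ : 1 + - 2^-1 = 2^-1); last by lra.
by rewrite lnV ?posrE// => /(_ ltac:(lra)); rewrite lerN2.
Qed.

(** * Harmonic sums and moments of omega(n) *)

Definition harmonic_sum (R : realType) (N : nat) : R :=
  \sum_(1 <= i < N.+1) i%:R^-1.

(** Both bounds on the harmonic sum come by induction from ln (1 + u) <= u, here with u = -1/(N+2)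
    and in the next lemma with u = 1/(N+1). *)
Lemma harmonic_sum_le (R : realType) (N : nat) : (0 < N)%N ->
  harmonic_sum R N <= 1 + ln N%:R.
Proof.
rewrite /harmonic_sum; case: N => // N _.
elim: N => [|N ih]; first by rewrite big_nat1 invr1 ln1 addr0.
rewrite big_nat_recr//= (le_trans (lerD ih (lexx _)))// -addrA lerD2l.
have N1 : 0 < N.+1%:R :> R by rewrite ltr0n.
have N2 : 0 < N.+2%:R :> R by rewrite ltr0n.
rewrite -lerBrDl -opprB -ln_div ?posrE// lerNr.
have -> : N.+1%:R / N.+2%:R = 1 + - N.+2%:R^-1 :> R.
  by rewrite -[N.+1%:R](addrK 1) natr1 mulrBl mul1r divff// lt0r_neq0.
apply: le_ln1Dx; rewrite ltrN2 invf_lt1//.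
by rewrite ltr1n.
Qed.

Lemma harmonic_sum_ge (R : realType) (N : nat) : ln N.+1%:R <= harmonic_sum R N.
Proof.
rewrite /harmonic_sum; elim: N => [|N ih]; first by rewrite ln1 big_geq.
rewrite big_nat_recr//= -lerBlDr; apply: le_trans ih.
have N1 : 0 < N.+1%:R :> R by rewrite ltr0n.
have N2 : 0 < N.+2%:R :> R by rewrite ltr0n.
rewrite lerBlDr -lerBlDl -ln_div ?posrE//.
have -> : N.+2%:R / N.+1%:R = 1 + N.+1%:R^-1 :> R.
  by rewrite -natr1 mulrDl mul1r divff// lt0r_neq0.
by apply: le_ln1Dx; apply: (@lt_trans _ _ 0); rewrite ?invr_gt0// oppr_lt0.
Qed.

(** Count k-tuples with product n, give each the weight N / n >= 1, and drop the restriction on the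
    product: the total weight of all k-tuples is N times the k-th power of the harmonic sum. *)
Lemma sum_expn_primes_le (R : realType) (N k : nat) : (0 < N)%N ->
  \sum_(1 <= n < N.+1) k%:R ^+ size (primes n) <= N%:R * (1 + ln N%:R) ^+ k :> R.
Proof.
move=> N0; apply: (@le_trans _ _ (N%:R * harmonic_sum R N ^+ k)); last first.
  rewrite ler_wpM2l// lerXn2r ?nnegrE ?harmonic_sum_le//.
    by apply: sumr_ge0 => i _; rewrite invr_ge0.
  by rewrite addr_ge0// ln_ge0// ler1n.
pose w (t : {ffun 'I_k -> 'I_N.+1}) : R := \prod_i (t i)%:R^-1.
have w0 t : 0 <= w t by apply: prodr_ge0 => i _; rewrite invr_ge0.
have -> : harmonic_sum R N ^+ k = \sum_t w t.
  rewrite -(bigA_distr_bigA (fun (_ : 'I_k) (j : 'I_N.+1) => j%:R^-1 : R)).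
  rewrite prodr_const card_ord /harmonic_sum; congr (_ ^+ _).
  (* The index 0 adds nothing, because the inverse of 0 is 0. *)
  rewrite -(big_mkord predT (fun i => i%:R^-1 : R)) [in RHS]big_ltn//.
  by rewrite invr0; exact: (esym (add0r _)).
rewrite big_distrr/= big_nat.
apply: (@le_trans _ R (\sum_(1 <= n < N.+1 | (1 <= n < N.+1)%N)
    \sum_(t : {ffun 'I_k -> 'I_N.+1} | (\prod_i (t i : nat))%N == n) N%:R * w t)).
  apply: ler_sum => n /andP[n0 nN].
  rewrite -natrX; apply: (@le_trans _ _
      #|[set t : {ffun 'I_k -> 'I_N.+1} | (\prod_i t i)%N == n]%SET|%:R).
    by rewrite ler_nat expn_primes_le_tuples// n0.
  rewrite cardsE -sum1_card natr_sum; apply: ler_sum => t /eqP tn.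
  rewrite /w prodfV -natr_prod tn ler_pdivlMr ?ltr0n// mul1r ler_nat.
  by rewrite -ltnS.
(* After the exchange each tuple is counted for at most one n, namely its product. *)
rewrite -big_nat (exchange_big_dep predT)//=; apply: ler_sum => t _.
rewrite big_nat_cond; set x := \prod_(_ < _) _.
have [xN|xN] := boolP (1 <= x < N.+1)%N.
  rewrite (big_rem x)/= ?mem_index_iota// xN eqxx/= big1_seq ?addr0//.
  by move=> i /andP[/andP[_ /eqP <-]]; rewrite mem_rem_uniq ?iota_uniq// inE eqxx.
rewrite big1 ?mulr_ge0// => i /andP[iN /eqP xi]; by rewrite xi iN in xN.
Qed.

(** The number (e^r)^m / m! is one term of the exponential series at e^r. The parameter r stays free
    and is later set to the logarithm of the optimal number of colours. *)
Lemma factV_le_expR (R : realType) (r : R) (m : nat) :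
  m`!%:R^-1 <= expR (expR r - m%:R * r).
Proof.
rewrite expRB expRM_natl ler_pdivlMr ?exprn_gt0 ?expR_gt0// mulrC.
case: m => [|m]; first by rewrite expr0 mul1r invr1 -expR0 ler_expR expR_ge0.
by apply: le_trans (expR_ge1Dxn m (expR_ge0 r)); rewrite lerDr.
Qed.

(** Young's inequality with exponents 1/b and 1/(1-b) for the product of (m r)^b and y / r^b. The
    resulting term b m r is the one that the bound on 1/m! cancels. *)
Lemma powR_mul_le (R : realType) (b r m y : R) :
  0 < b < 1 -> 0 < r -> 0 <= m -> 0 <= y ->
  m `^ b * y <= b * (m * r) + (1 - b) * (y / r `^ b) `^ (1 - b)^-1.
Proof.
move=> /andP[b0 b1] r0 m0 y0; have b1' : 0 < 1 - b by rewrite subr_gt0.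
have rb0 : 0 < r `^ b by rewrite powR_gt0.
have := @conjugate_powR R ((m * r) `^ b) (y / r `^ b) b^-1 (1 - b)^-1.
rewrite !invrK !invr_gt0 subrKC -powRrM divff ?gt_eqF// powRr1; last first.
  by rewrite mulr_ge0// ltW.
rewrite powRM// ?(ltW r0)//.
have -> : m `^ b * r `^ b * (y / r `^ b) = m `^ b * y.
  by rewrite -mulrA; congr (_ * _); rewrite mulrC divfK// gt_eqF.
rewrite [_ * b]mulrC [_ * (1 - b)]mulrC.
by apply=> //; rewrite ?mulr_ge0 ?invr_ge0 ?powR_ge0.
Qed.

(** Sort the factorizations by their number m of factors; factors are at least 2, so 2^m <= N. *)
Lemma num_coprime_factorizations_le (R : realType) (n N : nat) : (0 < n <= N)%N ->
  (num_coprime_factorizations n)%:R <=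
    \sum_(m < (trunc_log 2 N).+1) m%:R ^+ size (primes n) / m`!%:R :> R.
Proof.
move=> /andP[n0 nN]; set M := trunc_log 2 N.
pose S (m : nat) := [set A : {set 'I_n.+1} | coprime_factorization A & #|A| == m]%SET.
apply: (@le_trans _ _ (\sum_(m < M.+1) #|S m|%:R)); last first.
  apply: ler_sum => m _; rewrite ler_pdivlMr ?ltr0n ?fact_gt0// -natrM -natrX ler_nat.
  by rewrite mulnC card_coprime_factorizations_size_le.
rewrite -natr_sum ler_nat /num_coprime_factorizations -sum1_card.
rewrite (partition_big (fun A : {set 'I_n.+1} => inord #|A| : 'I_M.+1) predT)//=.
apply: leq_sum => m _; rewrite sum1dep_card; apply: subset_leq_card.
apply/fintype.subsetP => A; rewrite !inE => /andP[Afact /eqP <-]; rewrite Afact/=.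
rewrite inordK// ltnS trunc_log_max//.
exact: leq_trans (coprime_factorization_size _ _ Afact) nN.
Qed.

Lemma trunc_log2_le (R : realType) (N : nat) : (0 < N)%N ->
  (trunc_log 2 N).+1%:R <= 2 * (1 + ln N%:R) :> R.
Proof.
move=> N0; set M := trunc_log 2 N.
have : ln (2 ^+ M) <= ln N%:R :> R.
  by rewrite ler_ln ?posrE ?exprn_gt0 ?ltr0n// -natrX ler_nat trunc_logP.
rewrite lnXn// -[_ *+ M]mulr_natr => MN.
have M2 : 2^-1 * M%:R <= ln 2 * M%:R :> R by rewrite ler_wpM2r// ln2_ge_half.
by rewrite -(natr1 M); lra.
Qed.

(** For each m, the moment bound, the bound on 1/m! and Young's inequality combine so that b m r
    cancels and the estimate no longer depends on m. Of the term 2 L, one L pays for rounding m^b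
    up; the other, with ln 2, pays for the number of values of m. *)
Lemma sum_factorizations_le (R : realType) (b r : R) (N : nat) :
  0 < b < 1 -> 0 < r -> (0 < N)%N ->
  \sum_(1 <= n < N.+1) (num_coprime_factorizations n)%:R `^ b <=
    N%:R * expR (2 * ln (1 + ln N%:R) + ln 2 + b * expR r +
      (1 - b) * (ln (1 + ln N%:R) / r `^ b) `^ (1 - b)^-1).
Proof.
move=> b01 r0 N0; have /andP[b0 b1] := b01.
have lnN0 : 0 <= ln N%:R :> R by rewrite ln_ge0 ?ler1n.
set L := ln (1 + ln N%:R); set M := trunc_log 2 N.
have L0 : 0 <= L by rewrite ln_ge0// lerDl.
have expL : expR L = 1 + ln N%:R by rewrite lnK// posrE ltr_wpDr.
set E := expR _.
apply: (@le_trans _ R (\sum_(1 <= n < N.+1) \sum_(m < M.+1)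
    (m%:R `^ b) ^+ size (primes n) * m`!%:R^-1 `^ b)).
  rewrite big_nat [leRHS]big_nat; apply: ler_sum => n nN.
  have F_le := @num_coprime_factorizations_le R n N nN.
  apply: (le_trans (ge0_ler_powR (ltW b0) _ _ F_le)); rewrite ?nnegrE//.
    by apply: sumr_ge0 => m _; rewrite divr_ge0.
  have a_ge0 (m : 'I_M.+1) : 0 <= m%:R ^+ size (primes n) / m`!%:R :> R.
    by rewrite divr_ge0.
  have b01' : 0 < b <= 1 by rewrite b0 ltW.
  apply: le_trans (ge0_sum_powR_le _ _ _ _ _ _ b01' a_ge0) _.
  by apply: ler_sum => m _; rewrite powRM ?invr_ge0 ?powR_expn.
rewrite exchange_big/=.
apply: (@le_trans _ R (\sum_(m < M.+1) N%:R * expR (L + b * expR r +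
      (1 - b) * (L / r `^ b) `^ (1 - b)^-1))); last first.
  rewrite sumr_const card_ord -[_ *+ M.+1]mulr_natr -mulrA ler_wpM2l// mulrC.
  apply: le_trans (ler_wpM2r (expR_ge0 _) (@trunc_log2_le R N N0)) _.
  rewrite -expL -{1}[2](@lnK R) ?posrE// -!expRD /E ler_expR; lra.
apply: ler_sum => m _; rewrite -mulr_suml.
(* The moment bound needs an integer base; k <= m^b + 1 costs one extra factor e^L. *)
set k := (Num.truncn (m%:R `^ b)).+1.
have mbk : m%:R `^ b <= k%:R by rewrite ltW// truncnS_gt.
have kmb : k%:R <= m%:R `^ b + 1 by rewrite -natr1 lerD2r truncn_le ?powR_ge0.
have sum_le : \sum_(1 <= n < N.+1) (m%:R `^ b) ^+ size (primes n) <= N%:R * expR L ^+ k.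
  rewrite expL; apply: le_trans (@sum_expn_primes_le R N k N0).
  by apply: ler_sum => n _; rewrite lerXn2r ?nnegrE ?powR_ge0.
apply: le_trans (ler_wpM2r (powR_ge0 _ _) sum_le) _.
rewrite -mulrA ler_wpM2l// -expRM_natl.
have fact_le : m`!%:R^-1 `^ b <= expR (b * (expR r - m%:R * r)).
  rewrite [b * _]mulrC expRM ge0_ler_powR ?nnegrE ?invr_ge0 ?expR_ge0 ?(ltW b0)//.
  exact: factV_le_expR.
apply: le_trans (ler_wpM2l (expR_ge0 _) fact_le) _.
rewrite -expRD ler_expR.
have young := @powR_mul_le R b r m%:R L b01 r0 (ler0n _ _) L0.
have kL : k%:R * L <= m%:R `^ b * L + L by rewrite -[X in _ + X]mul1r -mulrDl ler_wpM2r.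
rewrite mulrBr; move: young kL.
move: (m%:R `^ b * L) (k%:R * L) ((1 - b) * _) (b * expR r) (b * _) => X Y Z U V.
by clear; move=> young kL; lra.
Qed.

(** * Reciprocals of primes *)

Lemma ler_sum_inj (R : numDomainType) (I J : finType) (A : {pred I}) (B : {pred J})
    (h : I -> J) (G : J -> R) :
  {in A &, injective h} -> {homo h : i / i \in A >-> i \in B} ->
  {in B, forall j, 0 <= G j} ->
  \sum_(i in A) G (h i) <= \sum_(j in B) G j.
Proof.
move=> h_inj hAB G0; rewrite -(big_imset _ h_inj)/=.
rewrite [leRHS](bigID (mem (h @: A)%SET))/=.
rewrite (eq_bigl (fun j => (j \in B) && (j \in (h @: A)%SET))).
  by rewrite lerDl sumr_ge0// => j /andP[/G0].
move=> j /=; apply/esym/andb_idl => /imsetP[i iA ->]; exact: hAB.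
Qed.

(** A finite form of the Euler product, by induction on the list of primes. *)
Lemma smooth_sum_le (R : realType) (ps : seq nat) (N : nat) : all prime ps ->
  \sum_(n < N.+1 | (0 < n)%N && all [in ps] (primes n)) n%:R^-1 <=
    \prod_(p <- ps) (1 - p%:R^-1)^-1 :> R.
Proof.
elim: ps => [_|p ps ih /= /andP[p_prime ps_prime]].
  rewrite big_nil.
  have n1 (n : 'I_N.+1) : (0 < n)%N && all [in [::]] (primes n) -> n = 1%N :> nat.
    move=> /andP[n0]; have := primes_eq0 n.
    by case: (primes n) => //=; case: (n : nat) n0 => [|[|]].
  case: N n1 => [|N] n1; first by rewrite big1// => -[[|]].
  rewrite (bigD1 (inord 1))//=; last by rewrite inordK.
  rewrite big1 ?addr0 ?inordK ?invr1// => n /andP[/n1 n1' /eqP[]].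
  by apply/val_inj; rewrite /= inordK.
rewrite big_cons; set G := \sum_(n < _ | _) _.
have p0 : 0 < p%:R :> R by rewrite ltr0n prime_gt0.
have p1 : 0 < 1 - p%:R^-1 :> R.
  by rewrite subr_gt0 invf_lt1// ltr1n prime_gt1.
(* A smooth n divisible by p is p times a smooth number, so G <= G' + G / p
   where G' is the sum for [ps]. *)
rewrite mulrC ler_pdivlMr// mulrBr mulr1 lerBlDr.
rewrite {1}/G (bigID (fun n : 'I_N.+1 => p %| n)%N)/= addrC.
apply: lerD.
  apply: le_trans (ih ps_prime); rewrite [leRHS]big_mkcond [leLHS]big_mkcond/=.
  apply: ler_sum => n _; case: ifPn => [/andP[/andP[n0 /allP psn] pn]|_].
    rewrite n0 ifT//; apply/allP => q qn; have := psn q qn; rewrite inE => /predU1P[qp|//].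
    by move: qn; rewrite qp mem_primes (negPf pn) !andbF.
  by case: ifP => // _; rewrite invr_ge0.
rewrite /G mulr_suml.
pose h (n : 'I_N.+1) : 'I_N.+1 := inord (n %/ p).
have hE n : h n = (n %/ p)%N :> nat by rewrite inordK// ltnS (leq_trans (leq_div _ _))// -ltnS.
rewrite (eq_bigr (fun n : 'I_N.+1 => (h n)%:R^-1 / p%:R)); last first.
  move=> n /andP[_ pn]; rewrite hE -invfM -natrM.
  by rewrite divnK.
apply: ler_sum_inj.
- move=> n n' /andP[_ pn] /andP[_ pn'] /(congr1 val)/=; rewrite !hE => nn'.
  by apply/val_inj; rewrite /= -(divnK pn) nn' divnK.
- move=> n /andP[/andP[n0 /allP psn] pn]; rewrite unfold_in hE.
  rewrite divn_gt0 ?prime_gt0// dvdn_leq//=; apply/allP => q; rewrite mem_primes => /and3P[qp _ qn].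
  by apply: psn; rewrite mem_primes qp n0 (dvdn_trans qn) ?dvdn_div.
- by move=> n _; rewrite divr_ge0 ?invr_ge0.
Qed.

(** The cutoff at K keeps every term below 1/K, which controls the loss in [esym_ge]. *)
Definition prime_sum (R : realType) (K y : nat) : R :=
  \sum_(p < y.+1 | prime p && (K < p)%N) p%:R^-1.

(** Bound the harmonic sum by the Euler product over p <= y. A prime p > K contributes 1 + 1/(p-1)
    <= exp (1/p + (1/(p-1) - 1/p)), and the differences telescope to at most 1/K <= 1. *)
Lemma harmonic_sum_le_prime_sum (R : realType) (K y : nat) : (0 < K <= y)%N ->
  harmonic_sum R y <= K%:R * expR (prime_sum R K y + 1).
Proof.
move=> /andP[K0 Ky].
pose e (p : nat) : R := if prime p then (1 - p%:R^-1)^-1 else 1.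
have e0 p : 0 <= e p.
  rewrite /e; case: ifP => // /prime_gt0 p0.
  by rewrite invr_ge0 subr_ge0 invf_le1 ?ltr0n// ler1n.
apply: (@le_trans _ _ (\prod_(0 <= p < y.+1) e p)).
  rewrite /e -big_mkcond/= -big_filter.
  apply: le_trans (@smooth_sum_le R _ y _); last first.
    by apply/allP => p; rewrite mem_filter => /andP[].
  rewrite /harmonic_sum big_geq_mkord/= [leLHS]big_mkcond [leRHS]big_mkcond/=.
  apply: ler_sum => n _; case: ifPn => //= n0.
  rewrite ifT//; apply/allP => p; rewrite mem_primes => /and3P[pp _ pn].
  rewrite mem_filter pp mem_iota add1n ltnS prime_gt0//=.
  by rewrite (leq_trans (dvdn_leq n0 pn))// -ltnS.
(* Using the factor i/(i-1) for every integer i from 2 to k, prime or not, the product telescopes to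
   k. *)
have small (k : nat) : (0 < k)%N -> \prod_(0 <= p < k.+1) e p <= k%:R.
  elim: k => // -[|k] ih _; first by rewrite !big_nat_recr//= big_nil /e/= !mulr1.
  rewrite big_nat_recr//=; apply: le_trans (ler_wpM2r (e0 _) (ih isT)) _.
  have k1 : 0 < k.+1%:R :> R by rewrite ltr0n.
  have k2 : 0 < k.+2%:R :> R by rewrite ltr0n.
  rewrite /e; case: ifP => _; last by rewrite mulr1 ler_nat.
  have -> : 1 - k.+2%:R^-1 = k.+1%:R / k.+2%:R :> R.
    by rewrite -[X in _ = X / _](addrK 1) natr1 mulrBl mul1r divff// lt0r_neq0.
  by rewrite invf_div mulrC divfK// lt0r_neq0.
have step (l : nat) : \prod_(0 <= p < (K + l).+1) e p <=
    K%:R * expR (prime_sum R K (K + l) + (K%:R^-1 - (K + l)%:R^-1)).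
  elim: l => [|l ih].
    rewrite addn0 subrr addr0 (le_trans (small K K0))// ler_peMr//.
    by rewrite -expR0 ler_expR sumr_ge0// => p _; rewrite invr_ge0.
  rewrite addnS big_nat_recr//=; apply: le_trans (ler_wpM2r (e0 _) ih) _.
  rewrite -mulrA ler_wpM2l//; set k := (K + l)%N.
  have k0 : (0 < k)%N by rewrite addn_gt0 K0.
  have k1 : 0 < k%:R :> R by rewrite ltr0n.
  have k2 : 0 < k.+1%:R :> R by rewrite ltr0n.
  have psS : prime_sum R K k.+1 = prime_sum R K k + (if prime k.+1 then k.+1%:R^-1 else 0).
    rewrite /prime_sum [LHS]big_mkcond big_ord_recr/= -big_mkcond; congr (_ + _).
    by rewrite ltnS leq_addr andbT.
  rewrite psS /e; case: ifP => [kp|_]; last first.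
    rewrite mulr1 ler_expR addr0 lerD2l lerD2l lerN2.
    by rewrite lef_pV2 ?posrE// ler_nat.
  have -> : 1 - k.+1%:R^-1 = k%:R / k.+1%:R :> R.
    by rewrite -[X in _ = X / _](addrK 1) natr1 mulrBl mul1r divff// lt0r_neq0.
  rewrite invf_div.
  have -> : k.+1%:R / k%:R = 1 + k%:R^-1 :> R.
    by rewrite -natr1 mulrDl mul1r divff// lt0r_neq0.
  apply: le_trans (ler_wpM2l (expR_ge0 _) (expR_ge1Dx _)) _.
  by rewrite -expRD ler_expR -addrA subrK -addrA subrKC.
have := step (y - K)%N; rewrite subnKC// => /le_trans; apply.
rewrite ler_wpM2l// ler_expR lerD2l.
have : K%:R^-1 <= 1 :> R by rewrite invf_le1 ?ltr0n// ler1n.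
have : 0 <= y%:R^-1 :> R by rewrite invr_ge0.
lra.
Qed.

(** A weak form of Mertens' theorem: take logarithms of ln (y+1) <= K exp ([prime_sum] + 1). If y <
    K, then ln (y+1) <= y <= K suffices. *)
Lemma prime_sum_ge (R : realType) (K y : nat) : (0 < K)%N -> (0 < y)%N ->
  ln (ln y.+1%:R) <= ln K%:R + prime_sum R K y + 1 :> R.
Proof.
move=> K0 y0; have lny : 0 < ln y.+1%:R :> R by rewrite ln_gt0// ltr1n.
have ps0 : 0 <= prime_sum R K y by rewrite sumr_ge0// => p _; rewrite invr_ge0.
have KR : 0 < K%:R :> R by rewrite ltr0n.
have [Ky|yK] := leqP K y.
  rewrite -addrA -(expRK (prime_sum R K y + 1)) -lnM ?posrE ?expR_gt0//.
  rewrite ler_ln ?posrE ?mulr_gt0 ?expR_gt0//.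
  apply: le_trans (harmonic_sum_ge R y) _.
  by apply: harmonic_sum_le_prime_sum; rewrite K0.
rewrite -addrA ler_wpDr ?addr_ge0// ler_ln ?posrE//.
rewrite -natr1 addrC (le_trans (le_ln1Dx _))//; last by rewrite ler_nat ltnW.
by rewrite (@lt_le_trans _ _ 0)// oppr_lt0.
Qed.

(* Each of the at most j factors removed from the sum weighs at most c. *)
Lemma esym_ge (R : realFieldType) (T : finType) (P : {set T}) (w : T -> R) (c : R)
    (j i : nat) :
  (forall p, p \in P -> 0 <= w p <= c) -> 0 <= c -> j%:R * c <= \sum_(p in P) w p ->
  (i <= j)%N ->
  (\sum_(p in P) w p - j%:R * c) ^+ i <=
    i`!%:R * \sum_(B : {set T} | (B \subset P) && (#|B| == i)) \prod_(p in B) w p.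
Proof.
move=> wP c0; set S := \sum_(p in P) _ => jcS.
have w0 (B : {set T}) : B \subset P -> 0 <= \prod_(p in B) w p.
  by move=> /fintype.subsetP BP; apply: prodr_ge0 => p /BP/wP/andP[].
elim: i => [_|i ih ij].
  rewrite expr0 fact0 mul1r (bigD1 finset.set0)/= ?finset.sub0set ?cards0//.
  by rewrite big_set0 lerDl sumr_ge0// => B /andP[/andP[/w0]].
rewrite exprSr factS natrM [i.+1%:R * _]mulrC -mulrA.
apply: le_trans (ler_wpM2r _ (ih (ltnW ij))) _; first by rewrite subr_ge0.
rewrite -mulrA ler_wpM2l//.
(* Extend each i-set B by a further element p. Outside B the weights still sum to at least S - j c,
   as B has at most j elements of weight at most c. *)
apply: (@le_trans _ _ (\sum_(u : {set T} * T | (u.1 \subset P) && (#|u.1| == i) &&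
    (u.2 \in P :\: u.1)%SET) \prod_(p in (u.2 |: u.1)%SET) w p)).
  rewrite -(pair_big_dep (fun B : {set T} => (B \subset P) && (#|B| == i))
     (fun B p => p \in P :\: B)%SET (fun B p => \prod_(q in (p |: B)%SET) w q))/=.
  rewrite mulr_suml; apply: ler_sum => B /andP[BP /eqP Bi].
  apply: (@le_trans _ _ (\prod_(p in B) w p * \sum_(p in (P :\: B)%SET) w p)).
    rewrite ler_wpM2l ?w0// lerBlDr /S (big_setID B)/= addrC lerD2l.
    rewrite (finset.setIidPr BP).
    apply: (@le_trans _ _ (\sum_(p in B) c)).
      by apply: ler_sum => p pB; have /wP/andP[] := fintype.subsetP BP p pB.
    by rewrite sumr_const Bi -[c *+ i]mulr_natl ler_wpM2r// ler_nat ltnW.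
  rewrite mulr_sumr; apply: ler_sum => p; rewrite inE => /andP[pB _].
  by rewrite big_setU1//= mulrC.
(* Adding p to B and remembering p is injective, and each set of size i + 1 arises with at most i +
   1 choices of p. *)
apply: (@le_trans _ _ (\sum_(u : {set T} * T | (u.1 \subset P) && (#|u.1| == i.+1) &&
    (u.2 \in u.1)) \prod_(p in u.1) w p)).
  pose h (u : {set T} * T) := ((u.2 |: u.1)%SET, u.2).
  apply: (@ler_sum_inj _ _ _ [pred u : {set T} * T | (u.1 \subset P) && (#|u.1| == i) &&
    (u.2 \in P :\: u.1)%SET] [pred u : {set T} * T | (u.1 \subset P) && (#|u.1| == i.+1) &&
    (u.2 \in u.1)] h (fun u => \prod_(p in u.1) w p)).
  - move=> [B p] [B' p']; rewrite !inE/= => /andP[_ /andP[pB _]] /andP[_ /andP[pB' _]].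
    move=> [BB' pp']; rewrite -{}pp' in pB' BB' *; congr (_, _).
    by rewrite -(finset.setU1K pB) BB' finset.setU1K.
  - move=> [B p]; rewrite !inE/= => /andP[/andP[BP /eqP Bi] /andP[pB pP]].
    by rewrite eqxx/= andbT finset.subUset finset.sub1set pP BP cardsU1 pB Bi eqxx.
  - by move=> u; rewrite inE => /andP[/andP[/w0]].
rewrite -(pair_big_dep (fun B : {set T} => (B \subset P) && (#|B| == i.+1))
     (fun B p => p \in B) (fun B p => \prod_(q in B) w q))/=.
rewrite mulr_sumr; apply: ler_sum => B /andP[_ /eqP Bi].
by rewrite sumr_const Bi mulr_natl.
Qed.

(** * The lower bound *)

(** Keep a single term of the binomial expansion of (1 + (v-1))^n. *)
Lemma expr_ge_bin (R : realDomainType) (v : R) (n j : nat) : 1 <= v ->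
  (v - 1) ^+ j * 'C(n, j)%:R <= v ^+ n.
Proof.
move=> v1; have v0 : 0 <= v - 1 by rewrite subr_ge0.
have [jn|nj] := leqP j n; last by rewrite bin_small// mulr0 exprn_ge0//; lra.
have := exprDn 1 (v - 1) n; rewrite subrKC => ->.
rewrite (bigD1 (inord j))//= inordK// expr1n mul1r mulr_natr lerDl.
by apply: sumr_ge0 => i _; rewrite mulrn_wge0// mulr_ge0// exprn_ge0.
Qed.

Lemma card_prime_sets_dvd (y n j : nat) (P : {set 'I_y.+1}) : (0 < n)%N ->
  {in P, forall p : 'I_y.+1, prime p} ->
  (\sum_(B : {set 'I_y.+1} | (B \subset P) && (#|B| == j)) (\prod_(p in B) p %| n)%N
    <= 'C(size (primes n), j))%N.
Proof.
move=> n0 Pprime; pose D := [set p in P | (p %| n)%N]%SET.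
apply: (@leq_trans 'C(#|D|, j)); last first.
  apply: leq_bin2l; rewrite cardE -(size_map val); apply: uniq_leq_size.
    by rewrite map_inj_uniq ?enum_uniq//; exact: val_inj.
  move=> _ /mapP[p + ->]; rewrite mem_enum inE => /andP[/Pprime pP pn].
  by rewrite mem_primes pP n0.
rewrite -cards_draws -sum1_card big_mkcond [leqRHS]big_mkcond/=.
apply: leq_sum => B _; rewrite inE.
case: ifP => // /andP[/fintype.subsetP BP ->]; rewrite andbT.
case: (boolP (_ %| n)%N) => // Bn; case: ifPn => // /negP[].
apply/fintype.subsetP => p pB; rewrite inE BP//= (dvdn_trans _ Bn)//.
by rewrite (bigD1 p)//= dvdn_mulr.
Qed.

(** With q = floor (N/d) >= 1, one has N < (q+1) d <= 2 q d. *)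
Lemma divn_ge_half (R : realFieldType) (N d : nat) : (0 < d <= N)%N ->
  N%:R / 2 * d%:R^-1 <= (N %/ d)%:R :> R.
Proof.
move=> /andP[d0 dN]; rewrite ler_pdivrMr ?ltr0n// ler_pdivrMr// -!natrM ler_nat.
have := ltn_ceil N d0; have : (0 < N %/ d)%N by rewrite divn_gt0.
by move: (N %/ d)%N => q; nia.
Qed.

(** Bound C(omega(n), j) below by the number of j-sets of primes in (j, y] whose product divides n.
    Such a product d is at most y^j <= N, so it divides at least N/(2d) of the n; summing 1/d gives
    the elementary symmetric function. *)
Lemma sum_expr_primes_ge (R : realType) (v : R) (N j y : nat) :
  1 <= v -> (0 < j)%N -> (y ^ j <= N)%N -> 1 <= prime_sum R j y ->
  N%:R / 2 * ((v - 1) * (prime_sum R j y - 1)) ^+ j / j`!%:R <=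
    \sum_(1 <= n < N.+1) v ^+ size (primes n).
Proof.
move=> v1 j0 yjN S1.
pose P := [set p : 'I_y.+1 | prime p && (j < p)%N]%SET.
pose w (p : 'I_y.+1) : R := p%:R^-1.
have jR : 0 < j%:R :> R by rewrite ltr0n.
have SE : \sum_(p in P) w p = prime_sum R j y.
  by apply: eq_bigl => p; rewrite inE.
have wP p : p \in P -> 0 <= w p <= j%:R^-1.
  rewrite inE => /andP[_ jp]; rewrite invr_ge0 ler0n/= lef_pV2 ?posrE//.
    by rewrite ler_nat ltnW.
  by rewrite ltr0n (leq_trans _ jp).
(* All primes used exceed j, so c = 1/j is allowed and the total loss j c is 1. *)
have := @esym_ge R _ P w j%:R^-1 j j wP.
rewrite SE divff ?gt_eqF// => /(_ _ S1 (leqnn j)) -/(_ ltac:(by rewrite invr_ge0)).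
set E := \sum_(B : {set _} | _) _ => SE_le.
have v0 : 0 <= v - 1 by rewrite subr_ge0.
apply: (@le_trans _ _ ((v - 1) ^+ j * (N%:R / 2 * E))).
  rewrite exprMn ler_pdivrMr ?ltr0n ?fact_gt0//.
  rewrite [leRHS](_ : _ = N%:R / 2 * ((v - 1) ^+ j * (j`!%:R * E))); last by ring.
  by rewrite ler_wpM2l// ?divr_ge0// ler_wpM2l// exprn_ge0.
apply: (@le_trans _ _ ((v - 1) ^+ j * (\sum_(1 <= n < N.+1)
    \sum_(B : {set 'I_y.+1} | (B \subset P) && (#|B| == j)) (\prod_(p in B) p %| n)%N)%:R)).
  rewrite ler_wpM2l ?exprn_ge0// exchange_big/= natr_sum /E mulr_sumr.
  apply: ler_sum => B /andP[/fintype.subsetP BP /eqP Bj].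
  rewrite -divn_count_dvd /w prodfV -natr_prod; apply: divn_ge_half.
  rewrite prodn_cond_gt0/=; last first.
    by move=> p /BP; rewrite inE => /andP[/prime_gt0].
  apply: leq_trans yjN; rewrite -Bj -prod_nat_const.
  by apply: leq_prod => p _; rewrite -ltnS.
rewrite natr_sum mulr_sumr big_nat [leRHS]big_nat; apply: ler_sum => n /andP[n0 _].
apply: le_trans (@expr_ge_bin R v _ j v1); rewrite ler_wpM2l ?exprn_ge0// ler_nat.
by apply: card_prime_sets_dvd => // p; rewrite inE => /andP[].
Qed.

Lemma num_coprime_factorizations_ge (R : realType) (b : R) (n m : nat) :
  0 <= b -> (0 < n)%N ->
  (m%:R `^ b) ^+ size (primes n) <=
    (m.+1%:R ^+ m) `^ b * (num_coprime_factorizations n)%:R `^ b.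
Proof.
move=> b0 n0; rewrite -powR_expn// -powRM ?exprn_ge0//.
by rewrite ge0_ler_powR ?nnegrE ?mulr_ge0 ?exprn_ge0// -!natrX -natrM ler_nat
  expn_primes_le_factorizations.
Qed.

(** Stirling's upper bound. The induction step reduces to e (j+1)^(j+2) <= (j+2)^(j+2), which is 1 -
    1/(j+2) <= exp (-1/(j+2)) raised to the power j+2. *)
Lemma fact_le_expR (R : realType) (j : nat) : (0 < j)%N ->
  j`!%:R <= expR 1 * j%:R * (j%:R / expR 1) ^+ j :> R.
Proof.
case: j => // j _; elim: j => [|j ih].
  by rewrite expr1 mulr1 div1r divff ?gt_eqF ?expR_gt0.
have k1 : 0 < j.+1%:R :> R by rewrite ltr0n.
have k2 : 0 < j.+2%:R :> R by rewrite ltr0n.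
rewrite factS natrM; apply: le_trans (ler_wpM2l _ ih) _ => //.
have key : expR 1 * j.+1%:R ^+ j.+2 <= j.+2%:R ^+ j.+2 :> R.
  have : expR (- j.+2%:R^-1) >= j.+1%:R / j.+2%:R :> R.
    rewrite -[X in X / _](addrK 1) natr1 mulrBl mul1r divff ?gt_eqF//.
    exact: expR_ge1Dx.
  rewrite ler_pdivrMr// => le1.
  have : j.+1%:R ^+ j.+2 <= (expR (- j.+2%:R^-1) * j.+2%:R) ^+ j.+2 :> R.
    by rewrite lerXn2r ?nnegrE ?mulr_ge0 ?expR_ge0.
  rewrite exprMn -expRM_natl mulrN divff ?gt_eqF// expRN => le2.
  by rewrite -ler_pdivlMl ?expR_gt0.
have e0 : 0 < expR 1 :> R by exact: expR_gt0.
have le3 : j.+1%:R * (j.+1%:R / expR 1) ^+ j.+1 <= (j.+2%:R / expR 1) ^+ j.+2 :> R.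
  rewrite !exprMn mulrA -exprS.
  have -> : j.+1%:R ^+ j.+2 * (expR 1)^-1 ^+ j.+1 =
      expR 1 * j.+1%:R ^+ j.+2 * (expR 1)^-1 ^+ j.+2 :> R.
    by rewrite [_^-1 ^+ j.+2]exprS mulrA [_ * _ / _]mulrAC divff ?mul1r// gt_eqF.
  by rewrite ler_wpM2r// exprn_ge0// invr_ge0 ltW.
by rewrite -(mulrA (expR 1) j.+1%:R) mulrCA mulrA ler_wpM2l//.
Qed.

(** With y = floor (x^(1/j)), ln (ln (y+1)) is at least ln (ln x) - ln j. The cutoff at j costs
    another ln j + 1 and [sum_expr_primes_ge] another 1, hence the term 2 ln j + 2. *)
Lemma sum_factorizations_ge_discrete (R : realType) (b V x : R) (m j : nat) :
  0 <= b -> 1 <= V <= m%:R `^ b -> 1 < x -> (0 < j)%N ->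
  0 <= ln (ln x) - 2 * ln j%:R - 2 ->
  x / 4 * ((V - 1) * (ln (ln x) - 2 * ln j%:R - 2)) ^+ j / j`!%:R <=
    (m.+1%:R ^+ m) `^ b * \sum_(1 <= n < (Num.truncn x).+1)
      (num_coprime_factorizations n)%:R `^ b.
Proof.
move=> b0 /andP[V1 Vm] x1 j0; set s := _ - 2 => s0.
have x0 : 0 < x by apply: lt_trans x1.
have lnx0 : 0 < ln x by rewrite ln_gt0.
have jR : 0 < j%:R :> R by rewrite ltr0n.
set N := Num.truncn x.
(* y is the integer part of x^(1/j). *)
pose y := Num.truncn (expR (ln x / j%:R)).
have y0 : (0 < y)%N.
  by rewrite truncn_gt0 -expR0 ler_expR divr_ge0// ltW.
have yjN : (y ^ j <= N)%N.
  rewrite truncn_ge_nat ?(ltW x0)// natrX.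
  apply: (@le_trans _ _ (expR (ln x / j%:R) ^+ j)).
    by rewrite lerXn2r ?nnegrE ?expR_ge0// truncn_le ?expR_ge0.
  by rewrite -expRM_natl mulrC divfK ?gt_eqF// lnK.
have lny : ln x / j%:R <= ln y.+1%:R.
  by rewrite -[leLHS]expRK ler_ln ?posrE ?expR_gt0// ltW// truncnS_gt.
have S1 : s <= prime_sum R j y - 1.
  have := @prime_sum_ge R j y j0 y0.
  have : ln (ln x / j%:R) <= ln (ln y.+1%:R).
    by rewrite ler_ln ?posrE ?divr_gt0// (lt_le_trans _ lny)// divr_gt0.
  by rewrite ln_div ?posrE// /s; lra.
have V0 : 0 <= V - 1 by rewrite subr_ge0.
have S2 : 1 <= prime_sum R j y by rewrite -subr_ge0 (le_trans s0).
apply: (@le_trans _ _ (\sum_(1 <= n < N.+1) V ^+ size (primes n))); last first.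
  rewrite mulr_sumr big_nat [leRHS]big_nat; apply: ler_sum => n /andP[n0 _].
  apply: le_trans (@num_coprime_factorizations_ge R b n m b0 n0).
  by rewrite lerXn2r ?nnegrE ?powR_ge0// (le_trans _ V1).
apply: le_trans (@sum_expr_primes_ge R V N j y V1 j0 yjN S2).
rewrite ler_wpM2r ?invr_ge0// ler_pM//.
- by rewrite divr_ge0// ltW.
- by rewrite exprn_ge0// mulr_ge0.
(* Here x < N + 1 <= 2 N, so N/2 >= x/4. *)
- have xN : x < N%:R + 1 by rewrite natr1 truncnS_gt.
  have N1 : 1 <= N%:R :> R by rewrite ler1n truncn_gt0 ltW.
  by move: (N%:R) xN N1 => N' xN N1; lra.
- have S3 : (V - 1) * s <= (V - 1) * (prime_sum R j y - 1) by rewrite ler_wpM2l.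
  have Vs0 : 0 <= (V - 1) * s by rewrite mulr_ge0.
  by rewrite lerXn2r ?nnegrE ?(le_trans Vs0 S3).
Qed.

(* The logarithm of the lower bound for the sum divided by x, obtained with
   about m colours and about W primes; t stands for ln (ln x). *)
Definition lower_exponent {R : realType} (b m t : R) : R :=
  let W := (m - 1) `^ b * t in
  (W - 1) * (1 + ln (((m - 1) `^ b - 1) * (t - 2 * ln W - 2) / W))
  - (1 + ln W + ln 4 + b * (m * ln (m + 1))).

(** Take k = floor m colours and j = floor W primes. V is built from m - 1 so that V <= k^b survives
    the rounding, while the cost of the colours is bounded with m itself. *)
Lemma sum_factorizations_ge (R : realType) (b m x : R) :
  let V := (m - 1) `^ b in let W := V * ln (ln x) in
  0 < b -> 1 < x -> 1 <= m -> 1 < V -> 1 <= W -> 0 < ln (ln x) - 2 * ln W - 2 ->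
  0 <= 1 + ln ((V - 1) * (ln (ln x) - 2 * ln W - 2) / W) ->
  x * expR (lower_exponent b m (ln (ln x))) <=
    \sum_(1 <= n < (Num.truncn x).+1) (num_coprime_factorizations n)%:R `^ b.
Proof.
move=> V W b0 x1 m1 V1 W1; rewrite /lower_exponent.
set t := ln (ln x) in W W1 *; rewrite -/V -/W; set s := t - _ - 2 => s0 D0.
set S := \sum_(_ <= _ < _) _.
pose k := Num.truncn m; pose j := Num.truncn W.
have x0 : 0 < x by apply: lt_trans x1.
have m0 : 0 <= m by apply: le_trans m1.
have W0 : 0 < W by apply: lt_le_trans W1.
have j0 : (0 < j)%N by rewrite truncn_gt0.
have jR : 0 < j%:R :> R by rewrite ltr0n.
have jW : j%:R <= W by rewrite truncn_le// ltW.
have Wj : W - 1 <= j%:R by rewrite lerBlDr natr1 ltW// truncnS_gt.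
have km : k%:R <= m by rewrite truncn_le.
have mk : m - 1 <= k%:R by rewrite lerBlDr natr1 ltW// truncnS_gt.
have Vk : 1 <= V <= k%:R `^ b.
  by rewrite (ltW V1) ge0_ler_powR ?nnegrE ?(ltW b0)// subr_ge0.
have lnjW : ln j%:R <= ln W by rewrite ler_ln ?posrE.
have sj : s <= t - 2 * ln j%:R - 2 by rewrite /s; lra.
have := @sum_factorizations_ge_discrete R b V x k j (ltW b0) Vk x1 j0.
rewrite -/t -/S => /(_ (le_trans (ltW s0) sj)).
have V0 : 0 < V - 1 by rewrite subr_gt0.
have lowj : x * expR (- ln 4 - 1 - ln W + (W - 1) * (1 + ln ((V - 1) * s / W))) <=
    x / 4 * ((V - 1) * (t - 2 * ln j%:R - 2)) ^+ j / j`!%:R.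
  rewrite [leRHS](_ : _ = x * (4^-1 *
    (((V - 1) * (t - 2 * ln j%:R - 2)) ^+ j / j`!%:R))); last by rewrite !mulrA.
  rewrite ler_wpM2l// ?(ltW x0)//.
  have e0 : 0 < expR 1 :> R by exact: expR_gt0.
  have num0 : 0 < ((V - 1) * s) ^+ j by apply: exprn_gt0; exact: mulr_gt0.
  have den0 : 0 < expR 1 * j%:R * (j%:R / expR 1) ^+ j :> R.
    by apply: mulr_gt0; [exact: mulr_gt0 | apply: exprn_gt0; exact: divr_gt0].
  (* Replace j! by its Stirling bound and ln j by ln W, then compare logarithms. *)
  apply: (@le_trans _ _ (4^-1 * (((V - 1) * s) ^+ j / (expR 1 * j%:R * (j%:R / expR 1) ^+ j)))).
    rewrite -[leRHS]lnK ?posrE ?mulr_gt0 ?invr_gt0//.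
    pose Q := ln ((V - 1) * s).
    have -> : ln (4^-1 * (((V - 1) * s) ^+ j / (expR 1 * j%:R * (j%:R / expR 1) ^+ j))) =
        - ln 4 + (j%:R * Q - (1 + ln j%:R + j%:R * (ln j%:R - 1))).
      rewrite lnM ?posrE ?invr_gt0 ?divr_gt0// lnV ?posrE//; congr (_ + _).
      rewrite ln_div ?posrE// lnXn ?mulr_gt0// -/Q -[Q *+ j]mulr_natl; congr (_ - _).
      rewrite lnM ?posrE ?mulr_gt0 ?exprn_gt0 ?divr_gt0// lnM ?posrE// expRK.
      by rewrite lnXn ?divr_gt0// ln_div ?posrE// expRK -[(_ - 1) *+ j]mulr_natl.
    have Vs_pos : (V - 1) * s \is Num.pos by rewrite posrE mulr_gt0.
    have W_pos : W \is Num.pos by rewrite posrE.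
    rewrite ler_expR; move: D0; rewrite ln_div//.
    rewrite -/Q; clearbody Q => D0.
    (* By [D0] the second factor is nonnegative, so j may be lowered to W - 1. *)
    have : (W - 1) * (1 + (Q - ln W)) <= j%:R * (1 + (Q - ln W)) by rewrite ler_wpM2r.
    have : j%:R * ln j%:R <= j%:R * ln W by rewrite ler_wpM2l.
    rewrite !mulrBr (mulrDr j%:R) (mulrBr j%:R) !mulr1.
    move: ((W - 1) * _) (j%:R * ln j%:R) (j%:R * ln W) (j%:R * Q) lnjW.
    move: (j%:R) (ln W) (ln j%:R) (ln 4) => A4 A1 A2 A3 B0 B1 B2 B3 H1 H2 H3.
    by clear - H1 H2 H3; lra.
  have Vs_le : (V - 1) * s <= (V - 1) * (t - 2 * ln j%:R - 2).
    by rewrite ler_wpM2l// ltW.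
  have Vs0 : 0 <= (V - 1) * s by apply: mulr_ge0; exact: ltW.
  rewrite ler_wpM2l ?invr_ge0// ler_pM ?invr_ge0 ?(ltW num0) ?(ltW den0)//.
    by rewrite lerXn2r ?nnegrE ?(le_trans Vs0 Vs_le).
  by rewrite lef_pV2 ?posrE ?ltr0n ?fact_gt0 ?fact_le_expR.
move=> /(le_trans lowj) => lowS.
have mm : (k.+1%:R ^+ k) `^ b <= expR (b * (m * ln (m + 1))).
  have -> : expR (b * (m * ln (m + 1))) = expR (m * ln (m + 1)) `^ b.
    by rewrite -expRM mulrC.
  rewrite ge0_ler_powR ?nnegrE ?(ltW b0) ?exprn_ge0 ?expR_ge0//.
  rewrite -[leLHS](@lnK R) ?posrE ?exprn_gt0//; rewrite ler_expR lnXn// -[ln _ *+ k]mulr_natl.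
  rewrite ler_pM// ?ln_ge0 ?ler1n//.
  by rewrite ler_ln ?posrE ?ltr_wpDl// -natr1 lerD2r.
have S0 : 0 <= S by apply: sumr_ge0 => n _; exact: powR_ge0.
have := le_trans lowS (ler_wpM2r S0 mm).
rewrite -ler_pdivrMl ?expR_gt0// -expRN mulrCA -expRD.
apply: le_trans; rewrite ler_wpM2l ?(ltW x0)// ler_expR.
move: ((W - 1) * _) (b * _) (ln W) (ln 4) => B1 B2 B3 B4.
by clear; lra.
Qed.

(** * Asymptotics of the exponents *)

Lemma near_cvg_eq {R : realType} {T : Type} {F : set_system T} {FF : Filter F}
    (f g : T -> R) (l : R) :
  (\forall t \near F, f t = g t) -> f t @[t --> F] --> l -> g t @[t --> F] --> l.
Proof. by move=> fg; apply: cvg_trans; exact: near_eq_cvg. Qed.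

Lemma cvg_powR {R : realType} {T : Type} {F : set_system T} {FF : Filter F}
    (f : T -> R) (a c : R) :
  0 < a -> f t @[t --> F] --> a -> f t `^ c @[t --> F] --> a `^ c.
Proof.
move=> a0 fa; rewrite {2}/powR gt_eqF//.
apply: (@near_cvg_eq _ _ _ _  (fun t => expR (c * ln (f t)))).
  near=> t; have ft : 0 < f t by near: t; exact: cvgr_gt fa _ a0.
  by rewrite /powR gt_eqF.
have lnf : ln (f t) @[t --> F] --> ln a.
  exact: (@continuous_cvg _ _ _ F FF f (@ln R) a (continuous_ln a0) fa).
apply: (@continuous_cvg _ _ _ _ _ (fun t => c * ln (f t)) expR).
  exact: continuous_expR.
exact: cvgMl_tmp.
Unshelve. all: by end_near. Qed.

Lemma cvgy_inv0 {R : realType} {T : Type} {F : set_system T} {FF : Filter F}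
    (f : T -> R) : f t @[t --> F] --> +oo -> (f t)^-1 @[t --> F] --> (0 : R).
Proof.
move=> fy; apply: (iffRL (gtr0_cvgV0 _)) => //.
exact: cvgry_gt fy 0.
Qed.

Lemma cvg_lny {R : realType} : ln t @[t --> +oo] --> (+oo : set_system R).
Proof.
apply/cvgryPge => A; near=> t.
have : expR A <= t by near: t; exact: nbhs_pinfty_ge (num_real _).
by move=> At; rewrite -[A]expRK ler_ln ?posrE ?expR_gt0// (lt_le_trans _ At)// expR_gt0.
Unshelve. all: by end_near. Qed.

(** From u^2/2 <= e^u with u = ln t one gets ln t / t <= 2 / ln t. *)
Lemma cvg_ln_div {R : realType} : ln t / t @[t --> +oo] --> (0 : R).
Proof.
apply: (@squeeze_cvgr _ _ _ _ (fun=> 0) (fun t : R => 2 * (ln t)^-1)).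
- near=> t; have t1 : 1 < t by near: t; exact: nbhs_pinfty_gt (num_real _).
  have t0 : 0 < t by apply: lt_trans t1.
  have lnt0 : 0 < ln t by rewrite ln_gt0.
  rewrite divr_ge0 ?(ltW lnt0) ?(ltW t0)//= ler_pdivrMr// mulrAC ler_pdivlMr// -expr2.
  have := @expR_ge1Dxn R (ln t) 1 (ltW lnt0); rewrite lnK// (_ : 2`! = 2)%N// => h.
  have : ln t ^+ 2 / 2 <= t by apply: le_trans h; rewrite lerDr.
  by rewrite ler_pdivrMr// mulrC.
- exact: cvg_cst.
- by rewrite -[X in _ --> X](mulr0 2); apply: cvgMl_tmp; apply: cvgy_inv0; exact: cvg_lny.
Unshelve. all: by end_near. Qed.

(* The number m of colours maximizing m^b t - b m ln m, up to a factor 1 + o(1). *)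
Definition opt_blocks {R : realType} (b t : R) : R :=
  ((1 - b) * t / ln t) `^ (1 - b)^-1.

(** The exponent of the theorem without its factor 1 + o(1), as a function of t = ln (ln x). *)
Definition main_exponent {R : realType} (b t : R) : R :=
  ((1 - b) * t / ln t `^ b) `^ (1 - b)^-1.

Lemma near_gt1 {R : realType} : \forall t \near (+oo : set_system R), 1 < t /\ 1 < ln t.
Proof.
near=> t; split; near: t; first exact: nbhs_pinfty_gt (num_real _).
exact: cvgry_gt cvg_lny 1.
Unshelve. all: by end_near. Qed.

Lemma main_exponentE {R : realType} (b t : R) : 0 < b < 1 -> 1 < t ->
  main_exponent b t = opt_blocks b t * ln t.
Proof.
move=> /andP[b0 b1] t1; have t0 : 0 < t by apply: lt_trans t1.
have l0 : 0 < ln t by rewrite ln_gt0.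
have b1' : 0 < 1 - b by rewrite subr_gt0.
rewrite /main_exponent /opt_blocks.
have lnE : (ln t `^ (1 - b)) `^ (1 - b)^-1 = ln t.
  by rewrite -powRrM divff ?gt_eqF// powRr1// ltW.
rewrite -[X in _ = _ * X]lnE -powRM ?powR_ge0//; last first.
  by rewrite divr_ge0 ?mulr_ge0// ltW.
rewrite powRB ?gt_eqF ?implybT// powRr1 ?(ltW l0)//; congr (_ `^ _).
by rewrite mulrA divfK ?gt_eqF.
Qed.

(** With z = (1-b) t / ln t and m = z^(1/(1-b)), the exponent identity 1/(1-b) = 1 + b/(1-b) gives m
    = z m^b. *)
Lemma main_exponent_powR {R : realType} (b t : R) : 0 < b < 1 -> 1 < t ->
  main_exponent b t = (1 - b) * t * opt_blocks b t `^ b.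
Proof.
move=> b01 t1; rewrite main_exponentE//.
have /andP[b0 b1] := b01; have t0 : 0 < t by apply: lt_trans t1.
have l0 : 0 < ln t by rewrite ln_gt0.
have b1' : 0 < 1 - b by rewrite subr_gt0.
rewrite /opt_blocks; set z := (1 - b) * t / ln t.
have z0 : 0 < z by rewrite divr_gt0// mulr_gt0.
have -> : (1 - b) * t = z * ln t by rewrite divfK// gt_eqF.
rewrite -powRrM mulrAC; congr (_ * _).
rewrite -{2}(powRr1 (ltW z0)) -powRD ?(gt_eqF z0) ?implybT//; congr (_ `^ _).
by rewrite -[X in _ = X + _](@mulVf _ (1 - b)) ?gt_eqF// -mulrDr subrK mulr1.
Qed.

Lemma cvg_opt_blocks {R : realType} (b : R) : 0 < b < 1 ->
  opt_blocks b t @[t --> +oo] --> (+oo : set_system R).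
Proof.
move=> /andP[b0 b1]; have b1' : 0 < 1 - b by rewrite subr_gt0.
have zy : (1 - b) * (ln t / t)^-1 @[t --> +oo] --> (+oo : set_system R).
  apply: gt0_cvgMry => //; apply: (iffRL (cvgrVy _)); last exact: cvg_ln_div.
  near=> t; have [t1 l1] : 1 < t /\ 1 < ln t by near: t; exact: near_gt1.
  by apply: divr_gt0; [apply: lt_trans l1 | apply: lt_trans t1].
refine (ger_cvgy _ zy); near=> t.
have z1 : 1 <= (1 - b) * (ln t / t)^-1 by near: t; exact: cvgry_ge zy 1.
have -> : opt_blocks b t = ((1 - b) * (ln t / t)^-1) `^ (1 - b)^-1.
  by rewrite /opt_blocks invf_div mulrA.
apply: le1r_powR => //.
by rewrite invf_ge1// lerBlDr lerDl ltW.
Unshelve. all: by end_near. Qed.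

Lemma cvg_ln_opt_blocks {R : realType} (b : R) : 0 < b < 1 ->
  ln (opt_blocks b t) / ln t @[t --> +oo] --> (1 - b)^-1.
Proof.
move=> /andP[b0 b1]; have b1' : 0 < 1 - b by rewrite subr_gt0.
apply: (@near_cvg_eq _ _ _ _ 
  (fun t => (1 - b)^-1 * (ln (1 - b) * (ln t)^-1 + 1 - ln (ln t) / ln t))).
  near=> t; have [t1 l1] : 1 < t /\ 1 < ln t by near: t; exact: near_gt1.
  have t0 : 0 < t by apply: lt_trans t1.
  have l0 : 0 < ln t by apply: lt_trans l1.
  rewrite /opt_blocks ln_powR -mulrA ln_div ?posrE ?mulr_gt0// lnM ?posrE//.
  by rewrite mulrBl mulrDl divff// gt_eqF.
rewrite -[X in _ --> X]mulr1; apply: cvgMl_tmp.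
have e : ln (1 - b) * 0 + 1 - 0 = 1 :> R by rewrite mulr0 add0r subr0.
rewrite -[X in _ --> X]e; apply: cvgB.
  apply: cvgD; last exact: cvg_cst.
  by apply: cvgMl_tmp; apply: cvgy_inv0; exact: cvg_lny.
exact: (cvg_comp _ _ cvg_lny cvg_ln_div).
Unshelve. all: by end_near. Qed.

Lemma cvg_ln_opt_blocks_shift {R : realType} (b c : R) : 0 < b < 1 ->
  1 + c * (opt_blocks b t)^-1 @[t --> +oo] --> (1 : R) /\
  ln (opt_blocks b t + c) / ln t @[t --> +oo] --> (1 - b)^-1.
Proof.
move=> b01; have my := cvg_opt_blocks b b01.
have c1 : 1 + c * (opt_blocks b t)^-1 @[t --> +oo] --> (1 : R).
  rewrite -[X in _ --> X]addr0; apply: cvgD; first exact: cvg_cst.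
  by rewrite -[X in _ --> X](mulr0 c); apply: cvgMl_tmp; apply: cvgy_inv0.
split => //.
apply: (@near_cvg_eq _ _ _ _  (fun t => ln (opt_blocks b t) / ln t +
   ln (1 + c * (opt_blocks b t)^-1) * (ln t)^-1)).
  near=> t.
  have m0 : 0 < opt_blocks b t by near: t; exact: cvgry_gt my 0.
  have c0 : 0 < 1 + c * (opt_blocks b t)^-1 by near: t; exact: cvgr_gt c1 _ ltr01.
  rewrite -mulrDl -lnM ?posrE//; congr (ln _ / _).
  by rewrite mulrDr mulr1 mulrCA divff ?mulr1// gt_eqF.
rewrite -[X in _ --> X]addr0; apply: cvgD; first exact: cvg_ln_opt_blocks.
rewrite -[X in _ --> X](mulr0 (ln (1 : R))); apply: cvgM.
  exact: (@continuous_cvg _ _ _ _ _ (fun t => 1 + c * (opt_blocks b t)^-1) (@ln R) 1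
    (continuous_ln ltr01) c1).
by apply: cvgy_inv0; exact: cvg_lny.
Unshelve. all: by end_near. Qed.

Lemma cvg_opt_blocks_powRV {R : realType} (b : R) : 0 < b < 1 ->
  (opt_blocks b t `^ b)^-1 @[t --> +oo] --> (0 : R).
Proof.
move=> b01; have /andP[b0 b1] := b01; have my := cvg_opt_blocks b b01.
apply: cvgy_inv0.
have lnm : b * ln (opt_blocks b t) @[t --> +oo] --> (+oo : set_system R).
  by apply: gt0_cvgMry => //; exact: (cvg_comp _ _ my cvg_lny).
refine (ger_cvgy _ lnm); near=> t.
have m0 : 0 < opt_blocks b t by near: t; exact: cvgry_gt my 0.
rewrite /powR gt_eqF//; apply: le_trans (expR_ge1Dx _).
by rewrite lerDr.
Unshelve. all: by end_near. Qed.

(** This makes every error term of order t negligible. *)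
Lemma cvg_div_main_exponent {R : realType} (b : R) : 0 < b < 1 ->
  t / main_exponent b t @[t --> +oo] --> (0 : R).
Proof.
move=> b01; have /andP[b0 b1] := b01; have b1' : 0 < 1 - b by rewrite subr_gt0.
apply: (@near_cvg_eq _ _ _ _  (fun t => (1 - b)^-1 * (opt_blocks b t `^ b)^-1)).
  near=> t; have [t1 l1] : 1 < t /\ 1 < ln t by near: t; exact: near_gt1.
  have t0 : 0 < t by apply: lt_trans t1.
  rewrite main_exponent_powR// !invfM [(1 - b)^-1 / t]mulrC !mulrA divff ?gt_eqF//.
  by rewrite mul1r.
rewrite -[X in _ --> X](mulr0 (1 - b)^-1); apply: cvgMl_tmp.
exact: cvg_opt_blocks_powRV.
Unshelve. all: by end_near. Qed.

Lemma powR_divr {R : realType} (x y c : R) : 0 <= x -> 0 < y ->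
  (x / y) `^ c = x `^ c / y `^ c.
Proof.
move=> x0 y0; have -> : x `^ c = (x / y) `^ c * y `^ c.
  by rewrite -powRM ?divr_ge0 ?(ltW y0)// divfK// gt_eqF.
by rewrite mulfK// gt_eqF// powR_gt0.
Qed.

(** The choice r = ln m makes e^r = m, which is the main exponent divided by ln t and hence
    negligible, as are the terms linear in t. The Young term carries the limit, since r / ln t tends
    to 1/(1-b). *)
Lemma cvg_upper_exponent {R : realType} (b : R) : 0 < b < 1 ->
  (2 * (t + ln 2) + ln 2 + b * expR (ln (opt_blocks b t)) +
     (1 - b) * ((t + ln 2) / ln (opt_blocks b t) `^ b) `^ (1 - b)^-1)
    / main_exponent b t @[t --> +oo] --> (1 : R).
Proof.
move=> b01; have /andP[b0 b1] := b01; have b1' : 0 < 1 - b by rewrite subr_gt0.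
have my := cvg_opt_blocks b b01.
have tT := cvg_div_main_exponent b b01.
have ty : t^-1 @[t --> +oo] --> (0 : R) by apply: cvgy_inv0; exact: cvg_id.
have lny : (ln t)^-1 @[t --> +oo] --> (0 : R) by apply: cvgy_inv0; exact: cvg_lny.
have lnm := cvg_ln_opt_blocks b b01.
pose c : R := ln 2; have c0 : 0 < c by rewrite ln_gt0// ltr1n.
rewrite -/c; apply: (@near_cvg_eq _ _ _ _ (fun t =>
  (2 + 3 * c * t^-1) * (t / main_exponent b t) + b * (ln t)^-1 +
  (1 - b) * ((1 + c * t^-1) *
    (((ln (opt_blocks b t) / ln t) `^ b)^-1 * (1 - b)^-1)) `^ (1 - b)^-1)).
  near=> t; have [t1 l1] : 1 < t /\ 1 < ln t by near: t; exact: near_gt1.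
  have t0 : 0 < t by apply: lt_trans t1.
  have l0 : 0 < ln t by apply: lt_trans l1.
  have m1 : 1 < opt_blocks b t by near: t; exact: cvgry_gt my 1.
  have m0 : 0 < opt_blocks b t by apply: lt_trans m1.
  have r0 : 0 < ln (opt_blocks b t) by rewrite ln_gt0.
  rewrite lnK ?posrE// [in RHS]mulrDl [in RHS]mulrDl; congr (_ + _ + _).
  - rewrite mulrA; congr (_ / _); rewrite mulrDl -mulrA mulVf ?gt_eqF// mulr1.
    by clear; clearbody c; lra.
  - by rewrite main_exponentE// invfM mulrA mulfK ?gt_eqF.
  - rewrite -mulrA; congr (_ * _); rewrite /main_exponent.
    rewrite -powR_divr ?divr_gt0 ?mulr_gt0 ?powR_gt0//; last first.
      by rewrite divr_ge0 ?powR_ge0// addr_ge0// ltW.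
    congr (_ `^ _); rewrite powR_divr ?(ltW r0)//.
    have := powR_gt0 b r0; have := powR_gt0 b l0.
    move: (ln _ `^ b) (ln _ `^ b) => B A B0 A0.
    by field; rewrite !gt_eqF.
(* With g = 1/(1-b), the last term tends to (1-b) (g^(-b) g)^g = (1-b) (g^(1-b))^g = (1-b) g = 1. *)
have e : (2 + 3 * c * 0) * 0 + b * 0 +
    (1 - b) * ((1 + c * 0) * (((1 - b)^-1 `^ b)^-1 * (1 - b)^-1)) `^ (1 - b)^-1 = 1.
  rewrite !mulr0 !add0r addr0 mul1r mulrC.
  have g0 : 0 < (1 - b)^-1 by rewrite invr_gt0.
  have -> : ((1 - b)^-1 `^ b)^-1 * (1 - b)^-1 = (1 - b)^-1 `^ (1 - b).
    by rewrite powRB ?(gt_eqF g0) ?implybT// powRr1 ?(ltW g0)// mulrC.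
  by rewrite -powRrM divff ?gt_eqF// powRr1 ?(ltW g0)// mulVf// gt_eqF.
rewrite -[X in _ --> X]e; apply: cvgD; first apply: cvgD.
- apply: cvgM => //; apply: cvgD; first exact: cvg_cst.
  exact: cvgMl_tmp.
- exact: cvgMl_tmp.
- apply: cvgMl_tmp; apply: cvg_powR.
    rewrite mulr0 addr0 mul1r; apply: mulr_gt0; last by rewrite invr_gt0.
    by rewrite invr_gt0 powR_gt0// invr_gt0.
  apply: cvgM.
    apply: cvgD; first exact: cvg_cst.
    exact: cvgMl_tmp.
  apply: cvgMr_tmp; apply: cvgV; first by rewrite gt_eqF// powR_gt0// invr_gt0.
  by apply: cvg_powR => //; rewrite invr_gt0.
Unshelve. all: by end_near. Qed.

(** Relative to the main exponent, W tends to 1/(1-b) and the cost b m ln (m+1) to b/(1-b); the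
    difference is 1. The logarithm multiplying W - 1 tends to 0 because V tends to infinity and ln W
    = o(t). The second conjunct provides the side conditions of [sum_factorizations_ge]. *)
Lemma cvg_lower_exponent {R : realType} (b : R) : 0 < b < 1 ->
  (lower_exponent b (opt_blocks b t) t / main_exponent b t @[t --> +oo] --> (1 : R)) /\
  \forall t \near (+oo : set_system R),
    let V := (opt_blocks b t - 1) `^ b in let W := V * t in
    [/\ 1 < V, 1 <= W, 0 < t - 2 * ln W - 2 &
        0 <= 1 + ln ((V - 1) * (t - 2 * ln W - 2) / W)].
Proof.
move=> b01; have /andP[b0 b1] := b01; have b1' : 0 < 1 - b by rewrite subr_gt0.
have my := cvg_opt_blocks b b01.
have tT := cvg_div_main_exponent b b01.
have ty : t^-1 @[t --> +oo] --> (0 : R) by apply: cvgy_inv0; exact: cvg_id.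
have [q1 lnm1] := cvg_ln_opt_blocks_shift b (-1) b01.
have [_ lnm1'] := cvg_ln_opt_blocks_shift b 1 b01.
pose m := @opt_blocks R b; pose T := @main_exponent R b.
pose V t := (m t - 1) `^ b; pose W t := V t * t.
pose s t := t - 2 * ln (W t) - 2.
pose q t : R := (1 + -1 * (m t)^-1) `^ b.
have p1 : 1 `^ b = 1 :> R by rewrite powR1.
have q_cvg : q t @[t --> +oo] --> (1 : R).
  by rewrite -[X in _ --> X]p1; exact: cvg_powR.
have near_pos : \forall t \near (+oo : set_system R),
    [/\ 0 < t, 0 < ln t, 2 < m t, 1 < V t & 0 < q t].
  near=> t; have [t1 l1] : 1 < t /\ 1 < ln t by near: t; exact: near_gt1.
  have m2 : 2 < m t by near: t; exact: cvgry_gt my 2.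
  have q0 : 0 < q t by near: t; exact: cvgr_gt q_cvg _ ltr01.
  have t0 : 0 < t by apply: lt_trans t1.
  have l0 : 0 < ln t by apply: lt_trans l1.
  have m1 : 1 < m t - 1 by lra.
  have V1 : 1 < V t by rewrite -p1 /V gt0_ltr_powR ?nnegrE// (le_trans ler01)// ltW.
  by split.
have VE : \forall t \near (+oo : set_system R), V t = m t `^ b * q t.
  near=> t; have [t0 l0 m2 V1 q0] : [/\ 0 < t, 0 < ln t, 2 < m t, 1 < V t & 0 < q t].
    by near: t.
  have m0 : 0 < m t by apply: lt_trans m2.
  have mV : (m t)^-1 < 1 by rewrite invf_lt1//; lra.
  rewrite /V /q -powRM ?(ltW m0)//; last by lra.
  by rewrite mulrDr mulr1 mulrCA divff ?gt_eqF// mulr1.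
have WT : W t / T t @[t --> +oo] --> (1 - b)^-1.
  apply: (@near_cvg_eq _ _ _ _ (fun t => q t * (1 - b)^-1)).
    near=> t; have [t1 _] : 1 < t /\ 1 < ln t by near: t; exact: near_gt1.
    have [t0 l0 m2 V1 q0] : [/\ 0 < t, 0 < ln t, 2 < m t, 1 < V t & 0 < q t].
      by near: t.
    rewrite /W (near VE t)// /T main_exponent_powR// -/(m t).
    have : 0 < m t `^ b by rewrite powR_gt0// (lt_trans _ m2).
    move: (m t `^ b) (q t) => M Q M0.
    by field; rewrite !gt_eqF.
  by rewrite -[X in _ --> X]mul1r; exact: cvgMr_tmp.
have lnWt : ln (W t) / t @[t --> +oo] --> (0 : R).
  apply: (@near_cvg_eq _ _ _ _ (fun t => (b * (ln (m t + -1) / ln t) + 1) * (ln t / t))).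
    near=> t; have [t0 l0 m2 V1 q0] : [/\ 0 < t, 0 < ln t, 2 < m t, 1 < V t & 0 < q t].
      by near: t.
    rewrite /W lnM ?posrE ?(lt_trans ltr01)// /V ln_powR mulrA; congr (_ / _).
    by rewrite mulrDl mul1r -mulrA divfK ?gt_eqF.
  rewrite -[X in _ --> X](mulr0 (b * (1 - b)^-1 + 1)); apply: cvgM; last exact: cvg_ln_div.
  by apply: cvgD; [exact: cvgMl_tmp|exact: cvg_cst].
have VV : (V t)^-1 @[t --> +oo] --> (0 : R).
  apply: (@near_cvg_eq _ _ _ _ (fun t => (m t `^ b)^-1 * (q t)^-1)).
    by near=> t; rewrite (near VE t)// invfM.
  rewrite -[X in _ --> X](mul0r (1^-1 : R)); apply: cvgM.
    exact: cvg_opt_blocks_powRV.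
  by apply: cvgV => //; exact: oner_neq0.
have st : s t / t @[t --> +oo] --> (1 : R).
  apply: (@near_cvg_eq _ _ _ _ (fun t => 1 - 2 * (ln (W t) / t) - 2 * t^-1)).
    near=> t; have [t0 l0 m2 V1 q0] : [/\ 0 < t, 0 < ln t, 2 < m t, 1 < V t & 0 < q t].
      by near: t.
    by rewrite /s mulrBl mulrBl divff ?gt_eqF// mulrA.
  have e : 1 - 2 * 0 - 2 * 0 = 1 :> R by lra.
  rewrite -[X in _ --> X]e; apply: cvgB; last exact: cvgMl_tmp.
  by apply: cvgB; [exact: cvg_cst|exact: cvgMl_tmp].
have D_cvg : 1 + ln ((V t - 1) * s t / W t) @[t --> +oo] --> (1 : R).
  rewrite -[X in _ --> X]addr0; apply: cvgD; first exact: cvg_cst.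
  rewrite -(@ln1 R); apply: (@near_cvg_eq _ _ _ _ (fun t => ln ((1 - (V t)^-1) * (s t / t)))).
    near=> t; have [t0 l0 m2 V1 q0] : [/\ 0 < t, 0 < ln t, 2 < m t, 1 < V t & 0 < q t].
      by near: t.
    have V0 : 0 < V t by apply: lt_trans V1.
    congr ln; rewrite /W; move: (V t) (s t) V0 => v z v0.
    by field; rewrite !gt_eqF.
  have c1 : (1 - (V t)^-1) * (s t / t) @[t --> +oo] --> (1 : R).
    have e : (1 - 0) * 1 = 1 :> R by lra.
    rewrite -[X in _ --> X]e; apply: cvgM => //.
    by apply: cvgB => //; exact: cvg_cst.
  exact: (@continuous_cvg _ _ _ _ _ _ (@ln R) 1 (continuous_ln ltr01) c1).
split; last first.
  near=> t; have [t0 l0 m2 V1 q0] : [/\ 0 < t, 0 < ln t, 2 < m t, 1 < V t & 0 < q t].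
    by near: t.
  move=> /=; rewrite -/(m t) -/(V t) -/(W t) -/(s t); split => //.
  - have t1 : 1 <= t by near: t; exact: nbhs_pinfty_ge (num_real _).
    by rewrite /W (le_trans t1)// ler_peMl// ltW.
  - have st0 : 0 < s t / t by near: t; exact: cvgr_gt st _ ltr01.
    by rewrite -[s t](divfK (lt0r_neq0 t0)) mulr_gt0.
  - by near: t; exact: cvgr_ge D_cvg _ ltr01.
apply: (@near_cvg_eq _ _ _ _ (fun t =>
  (W t / T t - t^-1 * (t / T t)) * (1 + ln ((V t - 1) * s t / W t)) -
  (((1 + ln 4) * t^-1 + ln (W t) / t) * (t / T t) + b * (ln (m t + 1) / ln t)))).
  near=> t; have [t1 _] : 1 < t /\ 1 < ln t by near: t; exact: near_gt1.
  have [t0 l0 m2 V1 q0] : [/\ 0 < t, 0 < ln t, 2 < m t, 1 < V t & 0 < q t].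
    by near: t.
  rewrite /lower_exponent -/(m t) -/(V t) -/(W t) -/(s t) -/(T t).
  have TE : T t = m t * ln t by rewrite /T main_exponentE.
  have m0 : 0 < m t by apply: lt_trans m2.
  rewrite TE; move: (W t) (ln (W t)) (1 + ln (_ / _)) (ln (m t + 1)) (ln 4) => W' w D l l4.
  move: (m t) (ln t) m0 l0 => M lt M0 lt0.
  by field; rewrite !gt_eqF.
have e : ((1 - b)^-1 - 0 * 0) * 1 - (((1 + ln 4) * 0 + 0) * 0 + b * (1 - b)^-1) = 1.
  rewrite !mulr0 subr0 mulr1 add0r -[X in X - _]mul1r -mulrBl divff// gt_eqF//.
rewrite -[X in _ --> X]e; apply: cvgB.
  apply: cvgM => //; apply: cvgB => //; exact: cvgM.
apply: cvgD; last exact: cvgMl_tmp.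
apply: cvgM => //; apply: cvgD => //; exact: cvgMl_tmp.
Unshelve. all: by end_near. Qed.

(** * Return to the variable x and conclusion *)

(** The upper bound with N = floor x and r = ln m. Since ln x >= 1, 1 + ln N <= 2 ln x, so L = ln (1
    + ln N) is at most t + ln 2. *)
Lemma sum_factorizations_le_exponent {R : realType} (b x : R) :
  let t := ln (ln x) in 0 < b < 1 -> 1 <= ln x -> 1 < opt_blocks b t ->
  \sum_(1 <= n < (Num.truncn x).+1) (num_coprime_factorizations n)%:R `^ b <=
  x * expR (2 * (t + ln 2) + ln 2 + b * expR (ln (opt_blocks b t)) +
     (1 - b) * ((t + ln 2) / ln (opt_blocks b t) `^ b) `^ (1 - b)^-1).
Proof.
move=> t b01 lx1 m1; have /andP[b0 b1] := b01.
have x1 : 1 < x.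
  rewrite ltNge; apply/negP => /ln_le0/(le_trans lx1).
  by rewrite ler10.
have x0 : 0 < x by apply: lt_trans x1.
have lx0 : 0 < ln x by apply: lt_le_trans lx1.
have r0 : 0 < ln (opt_blocks b t) by rewrite ln_gt0.
set N := Num.truncn x; have N0 : (0 < N)%N by rewrite truncn_gt0 ltW.
have NR : 0 < N%:R :> R by rewrite ltr0n.
have Nx : N%:R <= x by rewrite truncn_le// ltW.
have lnN : ln N%:R <= ln x by rewrite ler_ln.
have lnN0 : 0 <= ln N%:R :> R by rewrite ln_ge0// ler1n.
pose y : R := ln (1 + ln N%:R).
have y0 : 0 <= y by rewrite ln_ge0// lerDl.
have yt : y <= t + ln 2.
  rewrite /y /t -lnM ?posrE// ler_ln ?posrE ?mulr_gt0// ?(lt_le_trans ltr01) ?lerDl//.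
  by lra.
apply: le_trans (@sum_factorizations_le R b _ N b01 r0 N0) _; rewrite -/y.
apply: ler_pM; rewrite ?expR_ge0 ?(ltW NR)// ler_expR lerD//.
  by rewrite lerD2r lerD2r ler_pM2l.
have rb0 : 0 < ln (opt_blocks b t) `^ b by rewrite powR_gt0.
rewrite ler_wpM2l ?subr_ge0 ?(ltW b1)// ge0_ler_powR ?nnegrE//.
- by rewrite invr_ge0 subr_ge0 ltW.
- by rewrite divr_ge0 ?(ltW rb0).
- by rewrite divr_ge0 ?(ltW rb0)// (le_trans y0).
- by rewrite ler_wpM2r ?invr_ge0 ?(ltW rb0).
Qed.

Theorem theorem1p6 (R : realType) (beta : R) (hbeta0 : 0 < beta)
    (hbeta1 : beta < 1) :
  exists2 eps : R -> R, eps x @[x --> +oo] --> (0 : R) &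
    \forall x \near +oo,
      \sum_(1 <= n < (Num.truncn x).+1)
          (num_coprime_factorizations n)%:R `^ beta
      = x * expR ((1 + eps x) *
          ((1 - beta) * iter_ln 2 x / (iter_ln 3 x `^ beta))
            `^ (1 - beta)^-1).
Proof.
have b01 : 0 < beta < 1 by rewrite hbeta0.
pose t (x : R) := ln (ln x).
have t_cvg : t x @[x --> +oo] --> (+oo : set_system R).
  exact: (cvg_comp _ _ cvg_lny cvg_lny).
pose T x := main_exponent beta (t x).
pose S (x : R) : R := \sum_(1 <= n < (Num.truncn x).+1)
  (num_coprime_factorizations n)%:R `^ beta.
have [lower near_t] := cvg_lower_exponent beta b01.
have upper := cvg_upper_exponent beta b01.
have m_cvg := cvg_comp _ _ t_cvg (cvg_opt_blocks beta b01).
have along_t (P : R -> Prop) : (\forall u \near (+oo : set_system R), P u) ->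
    \forall x \near (+oo : set_system R), P (t x).
  by move=> near_P; exact: (t_cvg _ near_P).
have {}near_t := along_t _ near_t.
have near_x : \forall x \near (+oo : set_system R), [/\ 1 <= ln x, 1 < t x, 0 < T x,
    1 < opt_blocks beta (t x) &
    x * expR (lower_exponent beta (opt_blocks beta (t x)) (t x)) <= S x].
  near=> x.
  have lx : 1 <= ln x by near: x; exact: cvgry_ge cvg_lny 1.
  have x1 : 1 < x by near: x; exact: nbhs_pinfty_gt (num_real _).
  have tx : 1 < t x by near: x; exact: cvgry_gt t_cvg 1.
  have mx : 1 < opt_blocks beta (t x) by near: x; exact: cvgry_gt m_cvg 1.
  have /(_ _)[//|V1 W1 s0 D0] := near near_t x.
  have Tx : 0 < T x.
    by rewrite /T main_exponentE// mulr_gt0 ?ln_gt0// (lt_trans ltr01).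
  by split => //; apply: sum_factorizations_ge => //; exact: ltW.
(* This eps solves the required identity exactly wherever the sum and the main exponent are
   positive, so only its convergence to 0 needs the two bounds. *)
exists (fun x => ln (S x / x) / T x - 1); last first.
  near=> x; have /(_ _)[//|lx tx Tx _ lowS] := near near_x x.
  have x0 : 0 < x by near: x; exact: nbhs_pinfty_gt (num_real _).
  have Sx : 0 < S x by apply: lt_le_trans lowS; rewrite mulr_gt0 ?expR_gt0.
  rewrite -/(S x) -[X in expR (_ * X)]/(T x) subrKC divfK ?gt_eqF// lnK ?posrE ?divr_gt0//.
  by rewrite mulrC divfK// gt_eqF.
rewrite -[X in _ --> X](subrr 1); apply: cvgB; last exact: cvg_cst.
(* ln (S x / x) / T x lies between the normalized lower and upper exponents, both of which tend to 1
   along t = ln (ln x). *)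
apply: (squeeze_cvgr _ (cvg_comp _ _ t_cvg lower) (cvg_comp _ _ t_cvg upper)).
near=> x; have /(_ _)[//|lx tx Tx mx lowS] := near near_x x.
have x0 : 0 < x by near: x; exact: nbhs_pinfty_gt (num_real _).
have Sx : 0 < S x by apply: lt_le_trans lowS; rewrite mulr_gt0 ?expR_gt0.
have upS := @sum_factorizations_le_exponent R beta x b01 lx mx.
rewrite /= ler_pM2r ?invr_gt0// ler_pM2r ?invr_gt0//; apply/andP; split.
  by rewrite -ler_expR lnK ?posrE ?divr_gt0// ler_pdivlMr// mulrC.
by rewrite -ler_expR lnK ?posrE ?divr_gt0// ler_pdivrMr// mulrC.
Unshelve. all: by end_near. Qed.
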